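(* Let $n \geq 2$ be an integer and let $A \subset \mathbb{Z}$ be a set of integers containing arbitrarily large arithmetic progressions, i.e. for every integer $m \geq 1$ there exist $u_0 < \dots < u_{m-1}$ in $A$ such that $u_k = u_0 + k(u_1-u_0)$ for all $0 \leq k \leq m-1$. Let $\mathcal{B}_{A^{n-1}}$ be the smallest translation-invariant family of subsets of $\mathbb{R}^n$ containing the rectangles $R_{\boldsymbol{a}} = I_{a_1} \times \dots \times I_{a_{n-1}} \times I_{-(a_1+\dots+a_{n-1})}$ for all $\boldsymbol{a} = (a_1,\dots,a_{n-1}) \in A^{n-1}$, where $I_k = [0,2^k]$ for $k \in \mathbb{Z}$. Then there is a constant $c_n > 0$ depending only on $n$ such that for every integer $m \geq 1$ there exists a measurable set $E \subset \mathbb{R}^n$ with $0 < |E| < \infty$ and $$ \left| \left\{ x \in \mathbb{R}^n : M_{\mathcal{B}_{A^{n-1}}}\mathbf{1}_E(x) \geq 2^{-m} \right\} \right| \geq c_n\, m^{n-1}\, 2^m \left|E \right|.$$ In particular, the maximal operator $M_{\mathcal{B}_{A^{n-1}}}$ is sharply bounded from $L^1\left(1 + \log^+ L^1 \right)^{n-1}$ to $L^{1,\infty}$.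
   Context: $|U|$ denotes the $n$-dimensional Lebesgue measure of $U \subset \mathbb{R}^n$, $\mathbf{1}_E$ the indicator function of $E$, and $\log^+ x = \max(\log x, 0)$, with $\log^+ 0 = 0$. ''Axis-parallel rectangle'' means a product of $n$ bounded intervals of $\mathbb{R}$. For a translation-invariant family $\mathcal{B}$ of axis-parallel rectangles in $\mathbb{R}^n$, the associated maximal operator is $$M_{\mathcal{B}} f(x) := \sup_{x \in R \in \mathcal{B}} \frac{1}{|R|} \int_R |f| .$$ For a real number $k \geq 0$, the operator $M_{\mathcal{B}}$ is said to be sharply bounded from $L^1(1+\log^+ L^1)^k$ to $L^{1,\infty}$ when both of the following hold: (i) there is a constant $C$ depending only on $n$ and $\mathcal{B}$ such that for every measurable function $f$ on $\mathbb{R}^n$ and every $t > 0$, $$\left|\left\{M_{\mathcal{B}}f > t \right\}\right| \leq C \int_{\mathbb{R}^n} \frac{|f|}{t} \left(1 + \log^+ \frac{|f|}{t} \right)^{k};$$ (ii) for every convex increasing function $\phi : [0,\infty) \to [0,\infty)$ with $\lim_{x \to \infty} \frac{\phi(x)}{x(1+\log^+ x)^{k}} = 0$, the operator $M_{\mathcal{B}}$ is not bounded from the Orlicz space $L^\phi$ to $L^{1,\infty}$, meaning that there is no constant $C$ such that $\left|\left\{M_{\mathcal{B}}f > t \right\}\right| \leq C \int_{\mathbb{R}^n} \phi\left(\frac{|f|}{t}\right)$ for all measurable $f$ and all $t > 0$.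
   Formalization: In clause (ii) of sharp boundedness the functions φ are also required to satisfy φ(0) = 0, the usual Orlicz convention; without it the clause fails, e.g. for φ(x) = x + 1, where the right-hand side is always infinite. *)

(* Defs.v *)
From HB Require Import structures.
From mathcomp Require Import all_boot all_order all_algebra.
From mathcomp Require Import all_classical all_reals all_analysis.

Set Implicit Arguments.
Unset Strict Implicit.
Unset Printing Implicit Defensive.

Import Order.TTheory GRing.Theory Num.Theory.
Import numFieldNormedType.Exports.

Local Open Scope classical_set_scope.
Local Open Scope ring_scope.

Section lebesgue_Rn.
Variable R : realType.

Definition cons_pair n (p : measurableTypeR R * n.-tuple (measurableTypeR R)) :
  n.+1.-tuple (measurableTypeR R) := [tuple of p.1 :: p.2].

Lemma measurable_cons_pair n : measurable_fun setT (@cons_pair n).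
Proof. exact: measurable_cons. Qed.

Section cons_measure.
Variables (n : nat) (mu : {measure set (n.-tuple (measurableTypeR R)) -> \bar R}).

Definition cons_measure : set (n.+1.-tuple (measurableTypeR R)) -> \bar R :=
  pushforward (lebesgue_measure \x^ mu)%E (@cons_pair n).

Let cons_measure0 : cons_measure set0 = 0%E.
Proof. by rewrite /cons_measure /pushforward preimage_set0 measure0. Qed.

Let cons_measure_ge0 A : (0 <= cons_measure A)%E.
Proof.
apply: integral_ge0 => y _; apply/measure_ge0.
Qed.

Let cons_measure_sigma_additive : semi_sigma_additive cons_measure.
Proof.
by apply: measure_semi_sigma_additive; exact: measurable_cons_pair.
Qed.

HB.instance Definition _ := isMeasure.Build _ _ _ cons_measure
  cons_measure0 cons_measure_ge0 cons_measure_sigma_additive.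

End cons_measure.

(* Lebesgue measure on the Borel sets of R^n: the n-fold product measure. *)
Fixpoint borel_lebesgue n :
    {measure set (n.-tuple (measurableTypeR R)) -> \bar R} :=
  match n with
  | 0 => dirac [tuple]
  | n'.+1 => cons_measure (borel_lebesgue n')
  end.

(* R^n with the sigma-algebra of its Lebesgue measurable sets: the completion of
   the Borel sets, obtained by Caratheodory's construction. *)
Definition Rn n : measurableType _ :=
  caratheodory_type (borel_lebesgue n)^*%mu.

(* As a function on all subsets of R^n, this is the Lebesgue outer measure. *)
Definition lebesgue n : {measure set (Rn n) -> \bar R} :=
  @completed_measure_extension _ _ _ (borel_lebesgue n).

Lemma measurable_box n (i : 'I_n -> interval R) :
  measurable [set x : n.-tuple (measurableTypeR R) |
    forall j, tnth x j \in i j].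
Proof.
rewrite (_ : [set _ | _] =
    \bigcap_(j in setT) ((fun x => tnth x j) @^-1` [set` i j])).
  apply: fin_bigcap_measurable => // j _; rewrite -[X in measurable X]setTI.
  by apply: measurable_tnth => //; exact: measurable_itv.
by apply/seteqP; split=> x /= xi j; [move=> _; exact: xi|exact: xi].
Qed.

Lemma lebesgue_box n (a b : 'I_n -> R) : (forall j, a j <= b j) ->
  lebesgue n [set x | forall j, tnth x j \in `[a j, b j]] =
  (\prod_(j < n) (b j - a j))%:E.
Proof.
move=> ab; have mB := measurable_box (fun j => `[a j, b j]).
rewrite [LHS](measurable_mu_extE (borel_lebesgue n) mB) {mB}.
elim: n a b ab => [|n IH] a b ab /=.
  rewrite big_ord0 diracE mem_set//= => -[]//.
pose a' j := a (lift ord0 j); pose b' j := b (lift ord0 j).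
rewrite /cons_measure /pushforward.
rewrite (_ : _ @^-1` _ = `[a ord0, b ord0]%classic `*`
    [set x | forall j, tnth x j \in `[a' j, b' j]]); last first.
  apply/seteqP; split=> -[x y] /=.
    move=> xy; split; first by have := xy ord0; rewrite tnth0.
    by move=> j; have := xy (lift ord0 j); rewrite tnthS.
  move=> [xi yi] j; case: (unliftP ord0 j) => [k|] ->; last by rewrite tnth0.
  by rewrite tnthS; exact: yi.
rewrite product_measure2E//; last exact: (measurable_box (fun j => `[a' j, b' j])).
rewrite IH; last by move=> j; exact: ab.
rewrite [X in (X * _)%E]lebesgue_measure_itv /= lte_fin.
rewrite big_ord_recl EFinM; congr (_ * _)%E.
by case: ltgtP (ab ord0) => // -> _; rewrite subrr.
Qed.

End lebesgue_Rn.

Section maximal_operator.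
Variables (R : realType) (n : nat).

Definition translate (v x : Rn R n) : Rn R n :=
  [tuple tnth x i + tnth v i | i < n].

Definition translation_invariant (B : set (set (Rn R n))) :=
  forall (v : Rn R n) Q, B Q -> B (translate v @` Q).

Definition maximal (B : set (set (Rn R n))) (f : Rn R n -> R) (x : Rn R n) :
    \bar R :=
  ereal_sup [set ((lebesgue R n Q)^-1 *
    \int[lebesgue R n]_(y in Q) `|f y|%:E)%E | Q in [set Q | B Q /\ Q x]].

Definition logplus (x : R) : R := Num.max (ln x) 0.

Definition bounded_to_weakL1 (B : set (set (Rn R n))) (phi : R -> R) :=
  exists C : R, forall f : Rn R n -> R, measurable_fun setT f ->
  forall t : R, 0 < t ->
  (lebesgue R n [set x | t%:E < maximal B f x] <=
   C%:E * \int[lebesgue R n]_x (phi (`|f x| / t))%:E)%E.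

Definition LlogL (k x : R) : R := x * (1 + logplus x) `^ k.

(* [phi] stands for a function on [0, +oo[. As usual for Orlicz spaces it
   vanishes at 0: were [phi 0 > 0] allowed, the weak-type bound would hold
   trivially, its right-hand side being +oo. *)
Definition sharply_bounded (B : set (set (Rn R n))) (k : R) :=
  bounded_to_weakL1 B (LlogL k) /\
  forall phi : R -> R,
    (forall x, 0 <= x -> 0 <= phi x) ->
    phi 0 = 0 ->
    {in `[0, +oo[ &, {homo phi : x y / x <= y}} ->
    convex_function (`[0, +oo[%classic : set R) phi ->
    phi x / LlogL k x @[x --> +oo] --> (0 : R) ->
    ~ bounded_to_weakL1 B phi.

End maximal_operator.

Section lacunary_rectangles.
Variables (R : realType) (n : nat).

(* The last of the n exponents is minus the sum of the others. *)
Definition rectangle (a : n.-1.-tuple int) : set (Rn R n) :=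
  [set x | forall i : 'I_n,
     tnth x i \in `[0, (2 : R) ^ (rcons a (- \sum_(k <- a) k))`_i]].

Definition rectangles (A : set int) : set (set (Rn R n)) :=
  smallest (@translation_invariant R n)
    [set rectangle a | a in [set a | forall j, A (tnth a j)]].

End lacunary_rectangles.

Definition has_long_progressions (A : set int) := forall m : nat, (1 <= m)%N ->
  exists u : nat -> int,
    [/\ forall k, (k < m)%N -> A (u k),
        forall j k, (j < k < m)%N -> u j < u k &
        forall k, (k < m)%N -> u k = u 0%N + k%:Z * (u 1%N - u 0%N)].

(* Main.v *)
Require Import Defs.
From HB Require Import structures.
From mathcomp Require Import all_boot all_order all_algebra.
From mathcomp Require Import all_classical all_reals all_analysis.
From mathcomp Require Import measurable_realfun ring lra zify.

(* Upper bound: averages over boxes are dominated by the composition of the n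
   one-dimensional maximal operators.  Each of these is of weak type (1, 1) and
   bounded on L^oo, so applying it replaces an integral of [layered j] by an
   integral of [layered j.+1] (one more logarithm); the first operator applied
   only costs the passage from the indicator [layered 0] to an L^1 quantity.

   Lower bound: an arithmetic progression of step d in A gives rectangles with
   side exponents in n progressions p_0 < ... < p_m of step d, run through
   backwards in the last coordinate.  In each coordinate let U_k be the set of x
   in [0, 2^(p_m)[ whose binary digit just below 2^(p_j) vanishes for k < j <= m.
   Each dyadic interval of length 2^(p_k) that makes up U_k meets U_0 with density
   2^-k.  With E the product of the U_0, every point of a product of U_(k_i) with
   sum of the k_i equal to m lies in a rectangle in which E has density 2^-m, and
   such a product has measure 2^m |E|.  Replacing U_k by U_k \ U_(k-1) makes these
   products disjoint at the cost of a factor 2^n; there are at least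
   (m / (n-1))^(n-1) of them. *)

Set Implicit Arguments.
Unset Strict Implicit.
Unset Printing Implicit Defensive.

Import Order.TTheory GRing.Theory Num.Theory.
Import numFieldNormedType.Exports.

Local Open Scope classical_set_scope.
Local Open Scope ring_scope.

(** * The one-dimensional maximal operator *)

Section maximal1.
Variable R : realType.
Local Notation mu := (@lebesgue_measure R).
Implicit Types (f : R -> R) (g h : R -> \bar R).

(** Only the countably many radii [2 ^ k] occur, so measurability reduces to a countable supremum.
    The integral over an interval of length [2 * 2 ^ k] is divided by [2 ^ k] only, so that the
    average over any interval of length [2 ^ k] containing [x] is dominated with constant 1. *)
Definition maximal1 g (x : R) : \bar R :=
  ereal_sup (range (fun k : int =>
    ((2 ^ (- k))%:E * \int[mu]_(y in `[(x - 2 ^ k)%R, (x + 2 ^ k)%R]) g y)%E)).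

Lemma le_average_maximal1 g (a b x : R) (k : int) : measurable_fun setT g ->
  (forall y, (0 <= g y)%E) -> b = a + 2 ^ k -> x \in `[a, b] ->
  ((2 ^ (- k))%:E * \int[mu]_(y in `[a, b]) g y <= maximal1 g x)%E.
Proof.
move=> mg g0 ->; rewrite in_itv/= => /andP[ax xb].
apply: le_trans (ereal_sup_ubound _); last by exists k.
apply: lee_wpmul2l; first by rewrite lee_fin exprz_ge0.
apply: ge0_subset_integral => //.
  exact: measurable_funTS.
by move=> y /=; rewrite !in_itv/=; lra.
Qed.

Lemma maximal1_ge0 g x : (forall y, (0 <= g y)%E) -> (0 <= maximal1 g x)%E.
Proof.
move=> g0; apply: le_trans (ereal_sup_ubound _); last by exists 0.
by rewrite mule_ge0 ?lee_fin ?exprz_ge0 ?integral_ge0.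
Qed.

(** The constant [c] counts twice because [maximal1] divides by half the length of the interval. *)
Lemma le_maximal1D g h (c x : R) : 0 <= c -> measurable_fun setT g ->
  measurable_fun setT h -> (forall y, (0 <= g y)%E) ->
  (forall y, (0 <= h y)%E) -> (forall y, (g y <= h y + c%:E)%E) ->
  (maximal1 g x <= maximal1 h x + (2 * c)%:E)%E.
Proof.
move=> c0 mg mh g0 h0 gh; apply: ge_ereal_sup => _ [k _ <-].
have k0 : (0 : R) < 2 ^ k by rewrite exprz_gt0.
set I := `[_, _]%classic.
have muI : mu I = (2 * 2 ^ k)%:E.
  rewrite lebesgue_measure_itv/= lte_fin ltrD2l gt0_cp//.
  by congr (_%:E); ring.
have mI : measurable I by exact: measurable_itv.
have -> : (2 * c)%:E = ((2 ^ (- k))%:E * \int[mu]_(y in I) (c%:E))%E.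
  rewrite integral_cst// [X in (_ * (_ * X))%E](_ : _ = (2 * 2 ^ k)%:E)//.
  rewrite -!EFinM; congr (_%:E).
  rewrite -invr_expz; field; exact: lt0r_neq0.
apply: (@le_trans _ _ ((2 ^ (- k))%:E * (\int[mu]_(y in I) h y +
    \int[mu]_(y in I) c%:E))%E).
  apply: lee_wpmul2l; first by rewrite lee_fin exprz_ge0.
  rewrite -ge0_integralD//; last exact: measurable_funTS.
  apply: ge0_le_integral => //; first exact: measurable_funTS.
  by apply: emeasurable_funD => //; exact: measurable_funTS.
rewrite ge0_muleDr ?integral_ge0//.
by apply: leeD => //; apply: ereal_sup_ubound; exists k.
Qed.

(** The closed interval of radius [2 ^ k] lies in the open ball of radius [2 * 2 ^ k], whose length
    is 4 times the normalising factor [2 ^ k]. *)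
Lemma maximal1_HL f x : measurable_fun setT f -> (forall y, 0 <= f y) ->
  (maximal1 (EFin \o f) x <= 4%:E * HL_maximal f x)%E.
Proof.
move=> mf f0; apply: ge_ereal_sup => _ [k _ <-].
have k0 : (0 : R) < 2 ^ k by rewrite exprz_gt0.
apply: (@le_trans _ _ (4%:E * iavg f (ball x (2 * 2 ^ k)))%E); last first.
  apply: lee_wpmul2l => //; apply: ereal_sup_ubound.
  by exists (2 * 2 ^ k) => //=; rewrite in_itv/= andbT mulr_gt0.
rewrite /iavg lebesgue_measure_ball; last by rewrite mulr_ge0// ltW.
rewrite inver mulrn_eq0/= gt_eqF ?mulr_gt0// muleA -EFinM.
have -> : 4 * (2 * 2 ^ k *+ 2)^-1 = 2 ^ (- k) :> R.
  rewrite -invr_expz -mulr_natr; field; exact: lt0r_neq0.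
apply: lee_wpmul2l; first by rewrite lee_fin exprz_ge0.
under [in leRHS]eq_integral do rewrite /= ger0_norm//.
apply: ge0_subset_integral => //.
- exact: measurable_ball.
- by apply: measurable_funTS; exact/measurable_EFinP.
- by move=> y _ /=; rewrite lee_fin.
- move=> y /=; rewrite in_itv/= /ball/= => yx.
  by rewrite ltr_norml; lra.
Qed.

(** The constant 12 is the 3 of the Hardy-Littlewood inequality times the 4 of [maximal1_HL]. That
    inequality is about real-valued functions, so [g] gives way to [fine \o g], which agrees with it
    almost everywhere once the integral is finite. *)
Lemma weak_type_maximal1_integrable g (s : R) : 0 < s -> measurable_fun setT g ->
  (forall y, (0 <= g y)%E) -> measurable_fun setT (maximal1 g) ->
  (mu [set x | (s%:E < maximal1 g x)%E] <=
   (12 / s)%:E * \int[mu]_x g x)%E.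
Proof.
move=> s0 mg g0 mTg.
have [->|goo] := eqVneq (\int[mu]_x g x)%E +oo%E.
  by rewrite gt0_muley ?leey// lte_fin divr_gt0.
have {}goo : (\int[mu]_x g x < +oo)%E by rewrite ltey.
pose f := fine \o g.
have mf : measurable_fun setT f by exact: measurableT_comp.
have f0 y : 0 <= f y by rewrite fine_ge0.
have ig : mu.-integrable setT g.
  apply/integrableP; split=> //.
  by under eq_integral do rewrite gee0_abs//.
have gfae : ae_eq mu setT g (EFin \o f).
  have := integrable_ae measurableT ig.
  apply: filterS => y /(_ I) yfin _ /=; by rewrite fineK.
have mEf : measurable_fun setT (EFin \o f) by exact/measurable_EFinP.
have Ef0 y : (0 <= (EFin \o f) y)%E by rewrite lee_fin.
have TgE x : maximal1 g x = maximal1 (EFin \o f) x.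
  congr ereal_sup; apply: eq_imagel => k _; congr (_ * _)%E.
  apply: ge0_ae_eq_integral => //; try exact: measurable_funTS.
  by apply: filterS gfae => y /(_ I) gE _.
have lf : locally_integrable setT f.
  apply: open_integrable_locally; first exact: openT.
  apply/integrableP; split=> //; under eq_integral do rewrite gee0_abs//.
  by rewrite -(ge0_ae_eq_integral _ _ _ _ _ gfae).
rewrite (ge0_ae_eq_integral _ _ _ _ _ gfae)//.
apply: (@le_trans _ _ (mu [set x | ((s / 4)%:E < HL_maximal f x)%E])).
  apply: le_measure; rewrite ?inE.
  - rewrite -[X in measurable X]setTI; exact: emeasurable_fun_o_infty.
  - rewrite -[X in measurable X]setTI; apply: emeasurable_fun_o_infty => //.
    exact: measurable_HL_maximal.
  - move=> x /=; rewrite TgE => /lt_le_trans => /(_ _ (maximal1_HL x mf f0)).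
    by rewrite -lte_pdivrMl// -EFinM mulrC.
apply: le_trans (maximal_inequality lf _) _; first by rewrite divr_gt0.
have -> : 3 / (s / 4) = 12 / s by field; exact: lt0r_neq0.
apply: lee_wpmul2l; first by rewrite lee_fin divr_ge0// (ltW s0).
by rewrite /=; under eq_integral do rewrite ger0_norm//.
Qed.

End maximal1.

Lemma measurable_fun_ereal_sup_range (I : countType) d (T : measurableType d)
    (R : realType) (f : I -> T -> \bar R) :
  (forall i, measurable_fun setT (f i)) ->
  measurable_fun setT (fun x => ereal_sup (range (f^~ x))).
Proof.
move=> mf mD; apply: (measurability _ (ErealGenOInfty.measurableE R)) => //.
move=> _ [_ [r ->] <-]; rewrite setTI.
rewrite (_ : _ @^-1` _ = \bigcup_i [set x | (r%:E < f i x)%E]).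
  apply: countable_bigcupT_measurable; first exact: countableP.
  move=> i; rewrite -[X in measurable X]setTI; exact: emeasurable_fun_o_infty.
apply/seteqP; split=> x /=; rewrite in_itv/= andbT.
  by move=> /ereal_sup_gt[_ [i _ <-] ri]; exists i.
by case=> i _ ri; apply: lt_le_trans ri _; apply: ereal_sup_ubound; exists i.
Qed.

Section maximal1_parametric.
Variable R : realType.
Local Notation mu := (@lebesgue_measure R).

(** Joint measurability in the parameter and the point is what allows the operators to be iterated
    coordinate by coordinate. *)
Lemma measurable_maximal1_parametric d (P : measurableType d)
    (h : P * measurableTypeR R -> \bar R) :
  measurable_fun setT h -> (forall z, (0 <= h z)%E) ->
  measurable_fun setT (fun q => maximal1 (fun u => h (q.1, u)) q.2).
Proof.
move=> mh h0.
rewrite /maximal1; apply: measurable_fun_ereal_sup_range => k.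
apply: measurable_funeM.
(* Extension by zero turns the integral over a moving interval into a partial integral of a jointly
   measurable function. *)
pose H (z : (P * measurableTypeR R) * measurableTypeR R) : \bar R :=
  if (z.1.2 - 2 ^ k <= z.2) && (z.2 <= z.1.2 + 2 ^ k)
  then h (z.1.1, z.2) else 0%E.
have mH : measurable_fun setT H.
  apply: measurable_fun_ifT => //.
    apply: measurable_and; apply: measurable_fun_ler => //.
    - apply: measurable_funB => //; exact: measurableT_comp.
    - apply: measurable_funD => //; exact: measurableT_comp.
  apply: (measurableT_comp mh); apply: measurable_fun_pair => //.
  exact: measurableT_comp.
have H0 z : (0 <= H z)%E by rewrite /H; case: ifP.
have := measurable_fun_fubini_tonelli_F (m2 := mu) H mH H0.
apply: eq_measurable_fun => q _.
rewrite /fubini_F [RHS]integral_mkcond; apply: eq_integral => u _.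
by rewrite /H /patch/= mem_setE in_itv.
Qed.

Lemma measurable_maximal1 (g : R -> \bar R) : measurable_fun setT g ->
  (forall y, (0 <= g y)%E) -> measurable_fun setT (maximal1 g).
Proof.
move=> mg g0.
pose h (z : unit * measurableTypeR R) := g z.2.
have mh : measurable_fun setT h by exact: measurableT_comp.
have mT := @measurable_maximal1_parametric _ _ h mh (fun z => g0 z.2).
exact: (measurableT_comp mT (pair1_measurable tt)).
Qed.

(* The truncation [g <= g 1_{g > s/4} + s/4] loses at most [s/2] in the maximal
   function. *)
Lemma weak_type_maximal1 (g : R -> \bar R) (s : R) : 0 < s ->
  measurable_fun setT g -> (forall y, (0 <= g y)%E) ->
  (mu [set x | (s%:E < maximal1 g x)%E] <=
   (24 / s)%:E * \int[mu]_x (if (s / 4)%:E < g x then g x else 0))%E.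
Proof.
move=> s0 mg g0; pose g1 x := (if (s / 4)%:E < g x then g x else 0)%E.
have mg1 : measurable_fun setT g1.
  by apply: measurable_fun_ifT => //; exact: measurable_fun_lte.
have g10 y : (0 <= g1 y)%E by rewrite /g1; case: ifP.
have -> : 24 / s = 12 / (s / 2) by field; exact: lt0r_neq0.
have s20 : 0 < s / 2 by rewrite divr_gt0.
apply: le_trans (weak_type_maximal1_integrable s20 mg1 g10 _); last first.
  exact: measurable_maximal1.
apply: le_measure; rewrite ?inE.
- rewrite -[X in measurable X]setTI; apply: emeasurable_fun_o_infty => //.
  exact: measurable_maximal1.
- rewrite -[X in measurable X]setTI; apply: emeasurable_fun_o_infty => //.
  exact: measurable_maximal1.
- move=> x /= sTg.
  have s40 : 0 <= s / 4 by rewrite divr_ge0// ltW.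
  have gg1 y : (g y <= g1 y + (s / 4)%:E)%E.
    rewrite /g1; case: ltP => [_|]; last by rewrite add0e.
    by rewrite leeDl// lee_fin.
  have := lt_le_trans sTg (le_maximal1D x s40 mg mg1 g0 g10 gg1).
  rewrite -lteBlDr//; apply: le_lt_trans.
  by rewrite -EFinB lee_fin; lra.
Qed.

End maximal1_parametric.

(** * Integrals with logarithmic weights *)

(** Iterated partial sums of the sequence 1, 0, 0, ...: [layer_weight j.+1 i] is the binomial
    coefficient of [i + j] over [j], of degree [j] in [i], and so behaves like the [j]-th power of
    the logarithm of [2 ^+ i]. *)
Fixpoint layer_weight (j i : nat) : nat :=
  if j is j'.+1 then \sum_(l < i.+1) layer_weight j' l else (i == 0)%N.

Lemma layer_weight_gt0 j i : (0 < layer_weight j.+1 i)%N.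
Proof.
elim: j i => [|j IHj] i; rewrite [layer_weight _ _]/= big_ord_recl//.
by rewrite ltn_addr//; exact: IHj.
Qed.

Section layered.
Variable R : realType.
Local Notation mu := (@lebesgue_measure R).

(* Comparable to [(v / s) * (1 + logplus (v / s)) ^ (j - 1)] on [v > s], and
   to the indicator function of [v > s] for [j = 0]. *)
Definition layered (j : nat) (s : R) (v : \bar R) : \bar R :=
  (\sum_(i <oo) if (s * 2 ^+ i)%:E < v
                then ((layer_weight j i)%:R * 2 ^+ i)%:E else 0)%E.

Let term_ge0 j (s : R) (v : \bar R) (i : nat) : 
  (0 <= (if (s * 2 ^+ i)%:E < v
         then ((layer_weight j i)%:R * 2 ^+ i)%:E else 0 : \bar R))%E.
Proof. by case: ifP => // _; rewrite lee_fin mulr_ge0// exprn_ge0. Qed.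

Lemma layered_ge0 j s v : (0 <= layered j s v)%E.
Proof. exact: nneseries_ge0. Qed.

Lemma layered0 s v : layered 0 s v = (if s%:E < v then 1 else 0)%E.
Proof.
rewrite /layered nneseries_recl// expr0 !mulr1 eseries0 ?adde0// => i.
by case: i => // i _ _ /=; rewrite mul0r if_same.
Qed.

Lemma measurable_layered d (T : measurableType d) (f : T -> \bar R) j s :
  measurable_fun setT f -> measurable_fun setT (fun x => layered j s (f x)).
Proof.
move=> mf; apply: ge0_emeasurable_sum => // i _.
by apply: measurable_fun_ifT => //; exact: measurable_fun_lte.
Qed.

Lemma layered_fin j (s : R) (v : \bar R) (N : nat) : 0 <= s ->
  (v <= (s * 2 ^+ N)%:E)%E ->
  (layered j s v <= (\sum_(i < N) (layer_weight j i)%:R * 2 ^+ i)%:E)%E.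
Proof.
move=> s0 vN; rewrite /layered (nneseries_split 0 N)// add0n.
rewrite [X in (_ + X)%E]eseries0 ?adde0; last first.
  move=> i Ni _; rewrite ltNge (le_trans vN)// lee_fin ler_wpM2l//.
  by rewrite ler_weXn2l// ler1n.
by rewrite big_mkord -sumEFin; apply: lee_sum => i _; case: ifP => // _;
  rewrite lee_fin mulr_ge0// exprn_ge0.
Qed.

Lemma exists_pow2_cover (s v : R) : 0 < s -> exists N,
  v <= s * 2 ^+ N /\ forall i, (i < N)%N -> s * 2 ^+ i < v.
Proof.
move=> s0.
have exN : exists N, v <= s * 2 ^+ N.
  exists (Num.bound `|v / s|); rewrite mulrC -ler_pdivrMr//.
  apply: (le_trans (ler_norm _)); apply/ltW/(lt_trans (archi_boundP _)) => //.
  by rewrite -natrX ltr_nat ltn_expl.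
exists (ex_minn exN); case: ex_minnP => N vN minN; split=> // i iN.
by rewrite ltNge; apply: contraTN iN => /minN; rewrite -leqNgt.
Qed.

(** If exactly the levels [0, ..., N] lie below [v], the left side is [v / s] times a partial sum of
    weights, which is [layer_weight j.+1 N]. Since [v / s <= 2 * 2 ^+ N], it is at most twice the
    last nonzero term of [layered j.+1 s v]. *)
Lemma layered_step (j : nat) (s : R) (v : \bar R) : 0 < s -> (0 <= v)%E ->
  (\sum_(i <oo) ((layer_weight j i)%:R / s)%:E *
     (if (s * 2 ^+ i)%:E < v then v else 0) <= 2%:E * layered j.+1 s v)%E.
Proof.
move=> s0; case: v => [v|_|//].
- rewrite lee_fin => v0; have [N [vN ltNv]] := exists_pow2_cover v s0.
  have trm0 i : (0 <= ((layer_weight j i)%:R / s)%:E *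
     (if (s * 2 ^+ i)%:E < v%:E then v%:E else 0))%E.
    by case: ifP => _; rewrite ?mule0// lee_fin mulr_ge0// divr_ge0// ltW.
  rewrite (nneseries_split 0 N)// add0n.
  rewrite [X in (_ + X)%E]eseries0 ?adde0; last first.
    move=> i Ni _; rewrite ltNge lee_fin (le_trans vN) ?mule0//.
    by rewrite ler_wpM2l ?(ltW s0)// ler_weXn2l// ler1n.
  case: N => [|N] in vN ltNv *.
    by rewrite big_nil mule_ge0// layered_ge0.
  rewrite big_mkord (eq_bigr (fun i : 'I_N.+1 =>
      ((layer_weight j i)%:R * (v / s))%:E)); last first.
    move=> i _; rewrite lte_fin ltNv// -EFinM; congr EFin.
    by field; exact: lt0r_neq0.
  rewrite sumEFin -mulr_suml -natr_sum.
  apply: (@le_trans _ _ (2 * ((layer_weight j.+1 N)%:R * 2 ^+ N))%:E).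
    rewrite lee_fin [leRHS]mulrCA; apply: ler_wpM2l => //.
    by rewrite -exprS ler_pdivrMr// mulrC.
  rewrite EFinM lee_wpmul2l//.
  apply: le_trans (nneseries_lim_ge N.+1 _) => //.
  rewrite big_mkord big_ord_recr/= lte_fin ltNv//.
  by apply: leeDr; apply: sume_ge0 => i _; exact: (term_ge0 j.+1).
(* At infinity every layer is present, and its term is at least [2 ^+ i] because the weight is
   positive. *)
- suff -> : layered j.+1 s +oo%E = +oo%E by rewrite gt0_muley// leey.
  apply/eqyP => M _.
  have Mb := archi_boundP (normr_ge0 M).
  apply: le_trans (nneseries_lim_ge (Num.bound `|M|).+1 _) => //.
  rewrite big_mkord big_ord_recr/= ltry.
  apply: le_trans (leeDr _ _); last by apply: sume_ge0 => i _; exact: (term_ge0 j.+1).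
  rewrite lee_fin.
  apply: (le_trans (ler_norm _)); apply/ltW/(lt_le_trans Mb).
  apply: (@le_trans _ _ (2 ^+ Num.bound `|M|)).
    by rewrite -natrX ler_nat ltnW// ltn_expl.
  by rewrite ler_peMl ?exprn_ge0// ler1n layer_weight_gt0.
Qed.

(** The weak-type bound is applied to each layer at height [s * 2 ^+ i]: its factor
    [24 / (s * 2 ^+ i)] cancels the [2 ^+ i] of the layer and leaves [24 / s = 6 / (s / 4)]. Summing
    the layers by [layered_step] at threshold [s / 4] doubles the 6. *)
Lemma integral_layered_maximal1 j (s : R) (g : R -> \bar R) : 0 < s ->
  measurable_fun setT g -> (forall y, (0 <= g y)%E) ->
  (\int[mu]_x layered j s (maximal1 g x) <=
   12%:E * \int[mu]_x layered j.+1 (s / 4) (g x))%E.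
Proof.
move=> s0 mg g0; have mTg := measurable_maximal1 mg g0.
have s40 : 0 < s / 4 by rewrite divr_gt0.
pose c i : R := (layer_weight j i)%:R / (s / 4).
have c0 i : 0 <= c i by rewrite divr_ge0// ltW.
pose g_ i x := (if (s / 4 * 2 ^+ i)%:E < g x then g x else 0)%E.
have mg_ i : measurable_fun setT (g_ i).
  by apply: measurable_fun_ifT => //; exact: measurable_fun_lte.
have g_0 i y : (0 <= g_ i y)%E by rewrite /g_; case: ifP.
apply: (@le_trans _ _ (6%:E * \int[mu]_x \sum_(i <oo) (c i)%:E * g_ i x)%E);
    last first.
  rewrite (_ : 12%:E = 6%:E * 2%:E :> \bar R)%E; last first.
    by rewrite -EFinM; congr EFin; lra.
  rewrite -muleA lee_wpmul2l// -ge0_integralZl//; last 2 first.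
    exact: measurable_layered.
    by move=> x _; exact: layered_ge0.
  apply: ge0_le_integral => //.
  - by move=> x _; apply: nneseries_ge0 => i _ _; apply: mule_ge0 => //; rewrite lee_fin.
  - apply: ge0_emeasurable_sum => [i x _ _|i _]; last first.
      by apply: measurable_funeM; exact: mg_.
    by apply: mule_ge0 => //; rewrite lee_fin.
  - by apply: measurable_funeM; exact: measurable_layered.
  - by move=> x _; exact: layered_step.
rewrite integral_nneseries//; last first.
  move=> i; apply: measurable_fun_ifT => //; exact: measurable_fun_lte.
rewrite integral_nneseries//; last 2 first.
- by move=> i; apply: measurable_funeM; exact: mg_.
- by move=> i x _; apply: mule_ge0 => //; rewrite lee_fin.
rewrite -nneseriesZl//; last first.
  by move=> i _; apply: integral_ge0 => x _; apply: mule_ge0 => //; rewrite lee_fin.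
apply: lee_nneseries => [i _ _|i _].
  apply: integral_ge0 => x _; exact: term_ge0.
have s2i : 0 < s * 2 ^+ i by rewrite mulr_gt0// exprn_gt0.
rewrite ge0_integralZl//; [|exact: mg_|by rewrite lee_fin].
set W := (layer_weight j i)%:R * 2 ^+ i.
have W0 : 0 <= W by rewrite mulr_ge0// exprn_ge0.
pose A := [set x | ((s * 2 ^+ i)%:E < maximal1 g x)%E].
have mA : measurable A.
  rewrite -[X in measurable X]setTI; exact: emeasurable_fun_o_infty.
rewrite (_ : (\int[mu]_x _)%E = (W%:E * mu A)%E); last first.
  rewrite -[in RHS](setIT A) -integral_indic// -ge0_integralZl//; last first.
    by apply/measurable_EFinP; exact: measurable_indic.
  apply: eq_integral => x _; rewrite indicE; case: ifPn => xA.
    by rewrite mem_set ?mule1.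
  by rewrite memNset ?mule0//; exact/negP.
apply: le_trans (lee_wpmul2l _ (weak_type_maximal1 s2i mg g0)) _.
  by rewrite lee_fin.
rewrite !muleA -!EFinM.
have -> : s * 2 ^+ i / 4 = s / 4 * 2 ^+ i by rewrite mulrAC.
apply: lee_wpmul2r.
  by apply: integral_ge0 => x _; exact: (g_0 i).
rewrite lee_fin /W /c le_eqVlt; apply/orP; left; apply/eqP.
field.
by rewrite !lt0r_neq0// exprn_gt0.
Qed.

End layered.

(** * The strong maximal operator *)

Section borel_lebesgue.
Variable R : realType.
Local Notation mu := (@lebesgue_measure R).
Local Notation bl := (borel_lebesgue R).
Local Notation rn n := (n.-tuple (measurableTypeR R)).

Lemma sigma_finite_borel_lebesgue n : sigma_finite setT (bl n).
Proof.
exists (fun k : nat => [set x : rn n | forall j, tnth x j \in `[- k%:R, k%:R]]).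
  apply/esym/seteqP; split=> // x _.
  exists (\max_(j < n) Num.bound `|tnth x j|)%N => // j.
  rewrite in_itv/= -ler_norml.
  apply/ltW/(lt_le_trans (archi_boundP (normr_ge0 _))).
  by rewrite ler_nat (leq_bigmax (F := fun j => Num.bound `|tnth x j|)).
move=> k.
have mB := measurable_box (fun _ : 'I_n => `[- (k%:R : R), k%:R]).
split=> //.
rewrite -(measurable_mu_extE (bl n) mB).
rewrite [ltLHS](_ : _ = (\prod_(j < n) (k%:R - (- k%:R)))%:E) ?ltry//.
apply: (@lebesgue_box R n (fun=> - k%:R) (fun=> k%:R)) => j.
by rewrite (@le_trans _ _ 0)// oppr_le0.
Qed.

(** A named copy of the measure, to which the sigma-finite structure required by Tonelli's theorem
    is attached. *)
Definition borel_lebesgue_sf n : set (rn n) -> \bar R := bl n.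
Arguments borel_lebesgue_sf n : clear implicits.

HB.instance Definition _ n := isMeasure.Build _ _ _ (borel_lebesgue_sf n)
  (measure0 (bl n)) (measure_ge0 (bl n))
  (@measure_semi_sigma_additive _ _ _ (bl n)).

HB.instance Definition _ n := Measure_isSigmaFinite.Build _ _ _
  (borel_lebesgue_sf n) (sigma_finite_borel_lebesgue n).

(** The measure is the image under [cons_pair] of the product measure built by slicing in the
    opposite order; by uniqueness it is the usual product measure, for which Tonelli's theorem
    holds. *)
Lemma integral_borel_lebesgueS n (f : rn n.+1 -> \bar R) :
  measurable_fun setT f -> (forall x, (0 <= f x)%E) ->
  (\int[bl n.+1]_x f x = \int[bl n]_y \int[mu]_x f (cons_pair (x, y)))%E.
Proof.
move=> mf f0.
pose m2 : {sigma_finite_measure set (rn n) -> \bar R} :=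
  borel_lebesgue_sf n.
have mcp := @measurable_cons_pair R n.
have mfc : measurable_fun setT (f \o @cons_pair R n) by exact: measurableT_comp.
transitivity (\int[pushforward (mu \x^ m2)%E (@cons_pair R n)]_x f x)%E.
  by apply: eq_measure_integral.
rewrite ge0_integral_pushforward// preimage_setT.
transitivity (\int[(mu \x m2)%E]_z (f \o @cons_pair R n) z)%E.
  apply: eq_measure_integral => /= A mA _; apply/esym.
  by apply: product_measure_unique => //= *; rewrite product_measure2E.
by rewrite fubini_tonelli2//=.
Qed.

Lemma fubini_tonelli_borel_lebesgue n (f : rn n.+1 -> \bar R) :
  measurable_fun setT f -> (forall x, (0 <= f x)%E) ->
  (\int[bl n]_y \int[mu]_x f (cons_pair (x, y)) =
   \int[mu]_x \int[bl n]_y f (cons_pair (x, y)))%E.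
Proof.
move=> mf f0.
pose m2 : {sigma_finite_measure set (rn n) -> \bar R} :=
  borel_lebesgue_sf n.
have mfc : measurable_fun setT (f \o @cons_pair R n).
  by apply: measurableT_comp => //; exact: measurable_cons_pair.
exact: esym (fubini_tonelli (m1 := mu) (m2 := m2) _ mfc (fun z => f0 _)).
Qed.

End borel_lebesgue.

Lemma measurable_patch d (T : measurableType d) (R : realType) (D : set T)
    (f : T -> \bar R) :
  measurable D -> measurable_fun setT f -> measurable_fun setT (f \_ D).
Proof.
by move=> mD mf; apply/(measurable_restrictT f mD).1; exact: measurable_funTS.
Qed.

Section strong_maximal.
Variable R : realType.
Local Notation mu := (@lebesgue_measure R).
Local Notation bl := (borel_lebesgue R).
Local Notation rn n := (n.-tuple (measurableTypeR R)).

(** The operator in the first coordinate is outermost; the others act on the remaining coordinates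
    with the first one frozen at [u]. *)
Fixpoint strong_maximal n : (rn n -> \bar R) -> rn n -> \bar R :=
  match n with
  | 0 => fun f x => f x
  | n'.+1 => fun f x => maximal1
      (fun u => strong_maximal (fun z => f (cons_pair (u, z)))
                               [tuple of behead x]) (thead x)
  end.

Lemma strong_maximal_ge0 n (f : rn n -> \bar R) x : (forall y, (0 <= f y)%E) ->
  (0 <= strong_maximal f x)%E.
Proof.
elim: n f x => [|n IHn] f x f0 //=; apply: maximal1_ge0 => u.
by apply: IHn => z.
Qed.

Lemma measurable_strong_maximal_parametric d (P : measurableType d) n
    (f : P * rn n -> \bar R) :
  measurable_fun setT f -> (forall z, (0 <= f z)%E) ->
  measurable_fun setT (fun q => strong_maximal (fun z => f (q.1, z)) q.2).
Proof.
elim: n d P f => [|n IHn] d P f mf f0 /=.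
  by apply: (eq_measurable_fun _ _ mf) => -[].
pose g (w : (P * measurableTypeR R) * rn n) :=
  f (w.1.1, cons_pair (w.1.2, w.2)).
have mg : measurable_fun setT g.
  apply: (measurableT_comp mf); apply: measurable_fun_pair.
    exact: measurableT_comp.
  apply: (measurableT_comp (@measurable_cons_pair R n)).
  by apply: measurable_fun_pair => //; exact: measurableT_comp.
have mG := IHn _ _ g mg (fun w => f0 _).
pose h (w : (P * rn n) * measurableTypeR R) :=
  strong_maximal (fun z => g ((w.1.1, w.2), z)) w.1.2.
have mh : measurable_fun setT h.
  have mk : measurable_fun setT (fun w : (P * rn n) * measurableTypeR R =>
      ((w.1.1, w.2), w.1.2)).
    apply: measurable_fun_pair; last exact: measurableT_comp.
    by apply: measurable_fun_pair => //; exact: measurableT_comp.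
  exact: (measurableT_comp mG mk).
have h0 w : (0 <= h w)%E by apply: strong_maximal_ge0 => z; exact: f0.
have mT := @measurable_maximal1_parametric R _ _ h mh h0.
have mk : measurable_fun setT (fun q : P * rn n.+1 =>
    ((q.1, [tuple of behead q.2]), thead q.2)).
  apply: measurable_fun_pair.
    apply: measurable_fun_pair => //.
    exact: (measurableT_comp (@measurable_behead _ (measurableTypeR R) n)).
  apply: (measurableT_comp (@measurable_tnth _ (measurableTypeR R) n.+1 ord0)).
  exact: measurable_snd.
exact: (measurableT_comp mT mk).
Qed.

Lemma measurable_strong_maximal n (f : rn n -> \bar R) : measurable_fun setT f ->
  (forall z, (0 <= f z)%E) -> measurable_fun setT (strong_maximal f).
Proof.
move=> mf f0; pose h (z : unit * rn n) := f z.2.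
have mh : measurable_fun setT h by exact: measurableT_comp.
have mS := measurable_strong_maximal_parametric mh (fun z => f0 z.2).
exact: (measurableT_comp mS (pair1_measurable tt)).
Qed.

Let measurable_strong_maximal_cons n (f : rn n.+1 -> \bar R) :
  measurable_fun setT f -> (forall z, (0 <= f z)%E) ->
  measurable_fun setT (fun q : measurableTypeR R * rn n =>
    strong_maximal (fun z => f (cons_pair (q.1, z))) q.2).
Proof.
move=> mf f0.
pose g (w : measurableTypeR R * rn n) := f (cons_pair w).
have mg : measurable_fun setT g.
  exact: (measurableT_comp mf (@measurable_cons_pair R n)).
exact: (measurable_strong_maximal_parametric mg (fun w => f0 _)).
Qed.

(** By Tonelli, the average over the box is an average in the first coordinate of averages over the
    box of the others. Induction bounds the inner ones by [S], and [maximal1] bounds the outer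
    one. *)
Lemma le_average_strong_maximal n (f : rn n -> \bar R) (b : 'I_n -> int)
    (v : 'I_n -> R) (x : rn n) :
  measurable_fun setT f -> (forall z, (0 <= f z)%E) ->
  (forall i, tnth x i \in `[v i, v i + 2 ^ b i]) ->
  ((\prod_(i < n) 2 ^ (- b i))%:E *
   \int[bl n]_(y in [set y | forall i, tnth y i \in `[v i, (v i + 2 ^ b i)%R]])
      f y <= strong_maximal f x)%E.
Proof.
elim: n f b v x => [|n IHn] f b v x mf f0 xb /=.
  rewrite big_ord0 mul1e (_ : [set _ | _] = setT); last first.
    by apply/seteqP; split=> // y _ [].
  by rewrite integral_dirac// diracT mul1e (tuple0 x).
pose B : set (rn n.+1) :=
  [set y | forall i, tnth y i \in `[v i, v i + 2 ^ b i]].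
rewrite -/B; pose b' i := b (lift ord0 i); pose v' i := v (lift ord0 i).
pose B' := [set y : rn n | forall i, tnth y i \in `[v' i, v' i + 2 ^ b' i]].
have mB : measurable B by exact: (measurable_box (fun i => `[v i, v i + 2 ^ b i])).
have mfB := measurable_patch mB mf.
have fB0 y : (0 <= (f \_ B) y)%E by rewrite patchE; case: ifP.
have mScons := measurable_strong_maximal_cons mf f0.
pose S u := strong_maximal (fun z => f (cons_pair (u, z))) [tuple of behead x].
have mS : measurable_fun setT S.
  exact: (measurableT_comp mScons (pair2_measurable _)).
have S0 u : (0 <= S u)%E by apply: strong_maximal_ge0 => z; exact: f0.
have mfc := measurableT_comp mfB (@measurable_cons_pair R n).
rewrite [X in (_ * X)%E]integral_mkcond integral_borel_lebesgueS//.
rewrite fubini_tonelli_borel_lebesgue//.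
have p0 : 0 <= \prod_(i < n) 2 ^ (- b' i) :> R.
  by apply: prodr_ge0 => i _; exact: exprz_ge0.
apply: le_trans (le_average_maximal1 mS S0 erefl (x := thead x)
  (k := b ord0) (a := v ord0) _); last exact: xb.
rewrite big_ord_recl EFinM -muleA lee_wpmul2l//.
rewrite lee_fin exprz_ge0//.
have mF := measurable_fun_fubini_tonelli_F (m2 := @borel_lebesgue_sf R n) _ mfc
  (fun z => fB0 _).
have F0 u : (0 <= \int[bl n]_y (f \_ B) (cons_pair (u, y)))%E.
  by apply: integral_ge0 => y _; exact: fB0.
rewrite -ge0_integralZl//.
rewrite [leRHS]integral_mkcond; apply: ge0_le_integral => //.
- by move=> u _; rewrite mule_ge0// ?lee_fin// integral_ge0.
- apply: measurable_funeM.
  exact: (measurable_fun_fubini_tonelli_F (m2 := @borel_lebesgue_sf R n) _ mfc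
    (fun z => fB0 _)).
- exact: measurable_patch.
move=> u _; rewrite patchE; case: ifPn => uI.
- have mfu : measurable_fun setT (fun y : rn n => f (cons_pair (u, y))).
    exact: (measurableT_comp mf (measurableT_comp (@measurable_cons_pair R n)
      (pair1_measurable u))).
  have xb' i : tnth [tuple of behead x] i \in `[v' i, v' i + 2 ^ b' i].
    rewrite tnth_behead (_ : inord _ = lift ord0 i); first exact: xb.
    by apply/val_inj => /=; rewrite inordK// ltnS; exact: (ltn_ord i).
  apply: le_trans (IHn _ b' v' _ mfu (fun y => f0 _) xb').
  rewrite lee_wpmul2l ?lee_fin// [leRHS]integral_mkcond.
  have mB' : measurable (B' : set (rn n)).
    exact: (measurable_box (fun i => `[v' i, v' i + 2 ^ b' i])).
  apply: ge0_le_integral => //.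
  + exact: (measurableT_comp mfc (pair1_measurable u)).
  + exact: measurable_patch.
  + move=> y _; rewrite patchE; case: ifPn => [/set_mem uyB|_].
      rewrite patchE mem_set// => i.
      by have := uyB (lift ord0 i); rewrite tnthS.
    by rewrite patchE; case: ifPn.
- rewrite integral0_eq ?mule0// => y _; rewrite patchE; case: ifPn => //.
  move=> /set_mem/(_ ord0); rewrite tnth0 => uI'.
  by rewrite mem_set in uI.
Qed.

End strong_maximal.

Section integral_strong_maximal.
Variable R : realType.
Local Notation mu := (@lebesgue_measure R).
Local Notation bl := (borel_lebesgue R).
Local Notation rn n := (n.-tuple (measurableTypeR R)).

(** The one-dimensional estimate removes the outermost operator with the tail [y] fixed; after
    exchanging the integrals, the induction hypothesis handles the tail with [u] fixed. Each
    coordinate costs a factor 12, a quarter of the threshold and one more index in [layered]. *)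
Lemma integral_layered_strong_maximal n j (s : R) (f : rn n -> \bar R) :
  0 < s -> measurable_fun setT f -> (forall z, (0 <= f z)%E) ->
  (\int[bl n]_x layered j s (strong_maximal f x) <=
   (12 ^+ n)%:E * \int[bl n]_x layered (j + n) (s / 4 ^+ n) (f x))%E.
Proof.
elim: n j s f => [|n IHn] j s f s0 mf f0.
  by rewrite expr0 mul1e addn0 expr0 divr1.
have s40 : 0 < s / 4 by rewrite divr_gt0.
have mS := measurable_strong_maximal mf f0.
have S0 x : (0 <= strong_maximal f x)%E by exact: strong_maximal_ge0.
have mL := measurable_layered j s mS.
rewrite integral_borel_lebesgueS//; last by move=> x; exact: layered_ge0.
pose g u (y : rn n) := strong_maximal (fun z => f (cons_pair (u, z))) y.
have g0 u y : (0 <= g u y)%E by apply: strong_maximal_ge0.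
have mg : measurable_fun setT (fun q : measurableTypeR R * rn n => g q.1 q.2).
  have mfc := measurableT_comp mf (@measurable_cons_pair R n).
  exact: (measurable_strong_maximal_parametric mfc (fun w => f0 _)).
have mgy y : measurable_fun setT (fun u => g u y).
  exact: (measurableT_comp mg (pair2_measurable y)).
pose m2 := @borel_lebesgue_sf R n.
have mLg := measurable_layered j.+1 (s / 4) mg.
have Lg0 q : (0 <= layered j.+1 (s / 4) (g q.1 q.2))%E by exact: layered_ge0.
have mFf := measurable_layered (j + n.+1) (s / 4 ^+ n.+1) mf.
have Ff0 q : (0 <= layered (j + n.+1) (s / 4 ^+ n.+1) (f q))%E.
  exact: layered_ge0.
have mFfc := measurableT_comp mFf (@measurable_cons_pair R n).
apply: (@le_trans _ _ (12%:E *
    \int[bl n]_y \int[mu]_u layered j.+1 (s / 4) (g u y))%E).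
  rewrite -ge0_integralZl//; last 2 first.
  - exact: (measurable_fun_fubini_tonelli_G (m1 := mu) _ mLg Lg0).
  - by move=> y _; apply: integral_ge0 => u _; exact: layered_ge0.
  apply: ge0_le_integral => //.
  - by move=> y _; apply: integral_ge0 => u _; exact: layered_ge0.
  - exact: (measurable_fun_fubini_tonelli_G (m1 := mu) _
      (measurableT_comp mL (@measurable_cons_pair R n))
      (fun z => layered_ge0 _ _ _)).
  - apply: measurable_funeM.
    exact: (measurable_fun_fubini_tonelli_G (m1 := mu) _ mLg Lg0).
  - move=> y _.
    have -> : (fun x => layered j s (strong_maximal f (cons_pair (x, y)))) =
        (fun x => layered j s (maximal1 (g^~ y) x)).
      apply/funext => x /=; rewrite theadE; congr layered; congr maximal1.
      by apply/funext => u; congr strong_maximal; apply/val_inj.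
    exact: (integral_layered_maximal1 j s0 (mgy y) (fun u => g0 u y)).
rewrite [X in (_ * X <= _)%E](esym
  (fubini_tonelli (m1 := mu) (m2 := m2) _ mLg Lg0)).
rewrite exprS EFinM -muleA lee_wpmul2l//.
rewrite [X in (_ <= _ * X)%E](integral_borel_lebesgueS mFf Ff0).
rewrite [X in (_ <= _ * X)%E](fubini_tonelli_borel_lebesgue mFf Ff0).
have mH := measurable_fun_fubini_tonelli_F (m2 := m2) _ mFfc (fun z => Ff0 _).
have H0 u : (0 <= \int[bl n]_y layered (j + n.+1) (s / 4 ^+ n.+1)
    (f (cons_pair (u, y))))%E.
  by apply: integral_ge0 => y _; exact: Ff0.
rewrite -ge0_integralZl ?lee_fin ?exprn_ge0//.
apply: ge0_le_integral => //.
- by move=> u _; apply: integral_ge0 => y _; exact: layered_ge0.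
- exact: (measurable_fun_fubini_tonelli_F (m2 := m2) _ mLg Lg0).
- by apply: measurable_funeM; exact: mH.
move=> u _.
have mfu : measurable_fun setT (fun y : rn n => f (cons_pair (u, y))).
  exact: (measurableT_comp mf (measurableT_comp (@measurable_cons_pair R n)
    (pair1_measurable u))).
have := IHn j.+1 (s / 4) _ s40 mfu (fun y => f0 _).
rewrite addSnnS (_ : s / 4 / 4 ^+ n = s / 4 ^+ n.+1)//.
by rewrite exprS invfM mulrA.
Qed.

(** This is the case [j = 0], in which [layered] is the indicator of the superlevel set. *)
Lemma weak_type_strong_maximal n (s : R) (f : rn n -> \bar R) :
  0 < s -> measurable_fun setT f -> (forall z, (0 <= f z)%E) ->
  (bl n [set x | (s%:E < strong_maximal f x)%E] <=
   (12 ^+ n)%:E * \int[bl n]_x layered n (s / 4 ^+ n) (f x))%E.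
Proof.
move=> s0 mf f0.
have := integral_layered_strong_maximal 0 s0 mf f0; rewrite add0n.
apply: le_trans.
set A := [set x | _].
have mA : measurable A.
  rewrite -[X in measurable X]setTI; apply: emeasurable_fun_o_infty => //.
  exact: measurable_strong_maximal.
rewrite -[X in bl n X](setIT A) -integral_indic//.
apply: ge0_le_integral => //.
- by apply/measurable_EFinP; exact: measurable_indic.
- by apply: measurable_layered; exact: measurable_strong_maximal.
- move=> x _; rewrite layered0 indicE; case: ifPn => xA.
    by rewrite lee_fin lern1 leq_b1.
  by rewrite memNset//; exact/negP.
Qed.

End integral_strong_maximal.

(** * From Borel to Lebesgue measurable functions *)

Section lebesgue_borel.
Variables (R : realType) (n : nat).
Local Notation bl := (borel_lebesgue R n).
Local Notation leb := (lebesgue R n).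
Local Notation rn := (n.-tuple (measurableTypeR R)).

Lemma measurable_Rn (A : set rn) : measurable A -> measurable (A : set (Rn R n)).
Proof. by move=> mA; exact: (caratheodory_measurable_mu_ext bl). Qed.

Lemma lebesgue_borelE (A : set rn) : measurable A -> leb A = bl A.
Proof. by move=> mA; exact: (measurable_mu_extE bl). Qed.

(** Monotonicity of the outer measure holds for arbitrary sets, so superlevel sets of [maximal] can
    be compared without knowing them measurable. *)
Lemma le_lebesgue (A B : set (Rn R n)) : A `<=` B -> (leb A <= leb B)%E.
Proof. by move=> AB; exact: le_mu_ext. Qed.

Let measurable_idRn : measurable_fun setT (id : Rn R n -> rn).
Proof. by move=> _ A mA; rewrite setTI; exact: measurable_Rn. Qed.

Lemma measurable_fun_Rn d (T : measurableType d) (f : rn -> T) :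
  measurable_fun setT f -> measurable_fun setT (f : Rn R n -> T).
Proof. by move=> mf; exact: (measurableT_comp mf measurable_idRn). Qed.

Lemma integral_lebesgue_borel (D : set rn) (f : rn -> \bar R) :
  measurable D -> measurable_fun setT f -> (forall x, (0 <= f x)%E) ->
  (\int[leb]_(x in D) f x = \int[bl]_(x in D) f x)%E.
Proof.
move=> mD mf f0.
transitivity (\int[pushforward leb (id : Rn R n -> rn)]_(x in D) f x)%E.
  rewrite ge0_integral_pushforward//; exact: measurable_funTS.
by apply: eq_measure_integral => A mA _; rewrite /= /pushforward lebesgue_borelE.
Qed.

(** The hull is the intersection of countable Borel covers whose total measures exceed the outer
    measure by at most [1 / k.+1]. *)
Lemma borel_hull (A : set (Rn R n)) : (leb A < +oo)%E ->
  exists B : set rn, [/\ measurable B, A `<=` B & (bl B <= leb A)%E].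
Proof.
move=> Aoo.
have Afin : leb A \is a fin_num by rewrite ge0_fin_numE.
have cover k : exists F : nat -> set rn, [/\ forall i, measurable (F i),
    A `<=` \bigcup_i F i &
    (\sum_(i <oo) bl (F i) <= leb A + (k.+1%:R^-1)%:E)%E].
  have k0 : 0 < k.+1%:R^-1 :> R by rewrite invr_gt0.
  have [_ [F [mF AF] <-]] := lb_ereal_inf_adherent k0 Afin.
  by move=> /ltW ltF; exists F.
have [F /all_and3[mF AF leF]] := choice cover.
have mU k : measurable (\bigcup_i F k i) by exact: bigcupT_measurable.
exists (\bigcap_k \bigcup_i F k i); split.
- exact: bigcapT_measurable.
- by move=> x Ax k _; exact: AF.
- apply/lee_addgt0Pr => e e0.
  pose k := Num.bound e^-1.
  apply: (@le_trans _ _ (leb A + (k.+1%:R^-1)%:E)%E); last first.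
    rewrite leeD2l// lee_fin invf_ple ?posrE//.
    have e10 : 0 <= e^-1 by rewrite invr_ge0 ltW.
    by apply: (le_trans (ltW (archi_boundP e10))); rewrite ler_nat.
  apply: le_trans (leF k).
  apply: measure_sigma_subadditive => //.
  + exact: bigcapT_measurable.
  + by move=> x; exact.
Qed.

(** The estimates for [strong_maximal] need Borel functions. Here [g x] is the supremum of the
    positive rationals [q] such that [x] lies in a Borel hull of the set where [f > q]. It exceeds
    [f] only on the union of the differences between hulls and sets, which is null. *)
Lemma borel_majorant (f : Rn R n -> R) : measurable_fun setT f ->
  (forall x, 0 <= f x) ->
  (forall q : R, 0 < q -> (leb [set x | (q < f x)%R] < +oo)%E) ->
  exists g : rn -> \bar R, [/\ measurable_fun setT g,
    forall x, (0 <= g x)%E, forall x, ((f x)%:E <= g x)%E &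
    {ae leb, forall x, (g x <= (f x)%:E)%E}].
Proof.
move=> mf f0 ffin.
(* [q] enumerates the rationals; an index coding none gets the default 0, which adds only 0 to the
   supremum. *)
pose q k : R := ratr (odflt 0 (unpickle k : option rat)).
pose A k : set (Rn R n) := [set x | q k < f x].
have mA k : measurable (A k).
  rewrite -[X in measurable X]setTI.
  have mEf : measurable_fun setT (EFin \o f) by exact/measurable_EFinP.
  exact: (emeasurable_fun_o_infty measurableT mEf (q k)%:E).
have hull k : exists B : set rn, 0 < q k ->
    [/\ measurable B, A k `<=` B & (bl B <= leb (A k))%E].
  have [q0|] := boolP (0 < q k); last by exists set0.
  by have [B hB] := borel_hull (ffin _ q0); exists B.
have [B hB] := choice hull.
pose g (x : rn) := ereal_sup (range (fun k =>
  if (0 < q k) && (x \in B k) then (q k)%:E else 0%E)).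
have g0 x : (0 <= g x)%E.
  apply: le_trans (ereal_sup_ubound _); last by exists (pickle (0 : rat)).
  by rewrite /q pickleK/= rmorph0 ltxx.
exists g; split=> //.
- apply: measurable_fun_ereal_sup_range => k.
  have [q0|q0] := boolP (0 < q k); last exact: measurable_cst.
  apply: measurable_fun_ifT => //; apply: (measurable_fun_bool true).
  rewrite setTI (_ : _ @^-1` _ = B k); first by have [] := hB k q0.
  by apply/seteqP; split=> x /=; [exact: set_mem|exact: mem_set].
- move=> x; rewrite leNgt; apply/negP => gf.
  have gfin : g x \is a fin_num by rewrite ge0_fin_numE// (lt_trans gf)// ltry.
  move: gf; rewrite -(fineK gfin) lte_fin => /rat_in_itvoo[r].
  rewrite in_itv/= => /andP[gr rf].
  have q0 : 0 < q (pickle r).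
    by rewrite /q pickleK (le_lt_trans _ gr)// fine_ge0.
  have [_ AB _] := hB _ q0.
  move: gr; apply/negP; rewrite -leNgt -lee_fin fineK//.
  apply: ereal_sup_ubound; exists (pickle r) => //.
  rewrite q0 mem_set; first by rewrite /q pickleK.
  by apply: AB; rewrite /A/= /q pickleK.
- pose N k := if 0 < q k then B k `\` A k else set0.
  have N0 : leb.-negligible (\bigcup_k N k).
    apply: negligible_bigcup => k; rewrite /N; case: ifPn => [q0|_]; last first.
      exact: negligible_set0.
    have [mB AB BA] := hB k q0.
    have mBR := measurable_Rn mB.
    exists (B k `\` A k); split=> //; first exact: measurableD.
    have Aoo : (leb (A k) < +oo)%E := ffin _ q0.
    have lBA : (leb (B k) <= leb (A k))%E by rewrite lebesgue_borelE.
    have BA_eq : leb (B k) = leb (A k) by apply/eqP; rewrite eq_le lBA le_lebesgue.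
    apply: (etrans (measureD mBR (mA k) (le_lt_trans lBA Aoo))).
    rewrite setIidr// [X in (X - _)%E]BA_eq subee//.
    by rewrite ge0_fin_numE.
  apply: negligibleS N0 => x /=; apply: contra_notP => nN.
  apply: ge_ereal_sup => _ [k _ <-]; case: ifPn => [/andP[q0]|_].
    move=> /set_mem xB; rewrite lee_fin leNgt; apply/negP => fq.
    apply: nN; exists k => //; rewrite /N q0; split=> //.
    by move=> /(lt_trans fq); rewrite ltxx.
  by rewrite lee_fin.
Qed.

End lebesgue_borel.

(** * Comparison of the layered weights with L log L *)

Lemma layer_weight_le j i : (layer_weight j.+1 i <= i.+1 ^ j)%N.
Proof.
elim: j i => [|j IHj] i.
  by rewrite [layer_weight _ _]/= big_ord_recl big1.
rewrite [layer_weight _ _]/= expnS -[X in (X * _)%N]card_ord -sum_nat_const.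
apply: leq_sum => l _; apply: leq_trans (IHj l) _.
by case: (j) => // j'; rewrite leq_exp2r// ltn_ord.
Qed.

Section LlogL.
Variable R : realType.

Lemma logplus_ge0 (x : R) : 0 <= logplus x.
Proof. by rewrite le_max lexx orbT. Qed.

Lemma le_LlogL (k x : R) : 0 <= k -> 0 <= x -> x <= LlogL k x.
Proof.
move=> k0 x0; apply: ler_peMr => //.
apply: (@le_trans _ _ ((1 + logplus x) `^ 0)); first by rewrite powRr0.
by apply: ler_powR => //; rewrite lerDl logplus_ge0.
Qed.

Lemma measurable_LlogL (k : R) : measurable_fun setT (LlogL k).
Proof.
have mlp : measurable_fun setT (fun x : R => 1 + logplus x).
  by apply: measurable_funD => //; exact: measurable_maxr.
apply: measurable_funM => //.
exact: (measurableT_comp (@measurable_powR R k) mlp).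
Qed.

(** With [M.+1] levels below [v], the sum is at most [M.+1 ^ n * 2 ^ M.+1]. As [v] exceeds level
    [M], the power is at most [2 * 4 ^ n.+1 * (v / s)] and [M.+1] is at most a constant times
    [1 + logplus (v / s)]. *)
Lemma layered_le_LlogL (n : nat) : exists2 K : R, 0 <= K &
  forall s v : R, 0 < s -> 0 <= v ->
  (layered n.+1 (s / 4 ^+ n.+1) v%:E <= (K * LlogL n%:R (v / s))%:E)%E.
Proof.
pose a : R := ln (4 ^+ n.+1); pose l : R := ln 2.
have l0 : 0 < l by rewrite ln_gt0// ltr1n.
have a0 : 0 <= a by rewrite ln_ge0// exprn_ege1// ler1n.
(* Chosen so that [1 + (a + L) / l <= D * (1 + L)] for all [L >= 0], used with
   [L = logplus (v / s)]. *)
pose D : R := 1 + (a + 1) / l.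
have D0 : 0 <= D by rewrite addr_ge0// divr_ge0 ?addr_ge0// ltW.
exists (2 * 4 ^+ n.+1 * D ^+ n); first by rewrite !mulr_ge0// exprn_ge0.
move=> s v s0 v0.
pose sg := s / 4 ^+ n.+1.
have sg0 : 0 < sg by rewrite divr_gt0// exprn_gt0.
have [N [vN ltNv]] := exists_pow2_cover v sg0.
have L0 := logplus_ge0 (v / s).
apply: le_trans (layered_fin _ (ltW sg0) _) _; first by rewrite lee_fin; exact: vN.
rewrite lee_fin; case: N => [|M] in vN ltNv *.
  rewrite big_ord0 mulr_ge0//; first by rewrite !mulr_ge0// exprn_ge0.
  by rewrite /LlogL mulr_ge0 ?powR_ge0// divr_ge0// ltW.
have Mv := ltNv M (ltnSn M).
have v_gt0 : 0 < v by apply: lt_trans Mv; rewrite mulr_gt0// exprn_gt0.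
have M_le : M.+1%:R <= D * (1 + logplus (v / s)).
  have : M%:R * l <= a + logplus (v / s).
    have : ln (2 ^+ M : R) <= ln (v / sg).
      rewrite ler_ln ?posrE ?exprn_gt0 ?divr_gt0//.
      by rewrite ler_pdivlMr// mulrC ltW.
    rewrite lnXn// -(mulr_natl (ln 2) M) => /le_trans; apply.
    rewrite /sg invfM invrK mulrA lnM ?posrE ?divr_gt0 ?exprn_gt0//.
    by rewrite addrC lerD2l le_max lexx.
  rewrite -ler_pdivlMr// => M_le; rewrite -natr1 addrC.
  apply: le_trans (_ : 1 + (a + logplus (v / s)) / l <= _).
    by rewrite lerD2l.
  have -> : D * (1 + logplus (v / s)) = 1 + (a + logplus (v / s)) / l +
      (1 / l + logplus (v / s) + a / l * logplus (v / s)).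
    by rewrite /D; field; exact: lt0r_neq0.
  by rewrite lerDl !addr_ge0// ?mulr_ge0// ?invr_ge0 ?ltW.
apply: (@le_trans _ _ (M.+1%:R ^+ n * 2 ^+ M.+1)).
  apply: (@le_trans _ _ (\sum_(i < M.+1) M.+1%:R ^+ n * 2 ^+ i)).
    apply: ler_sum => i _; rewrite ler_wpM2r ?exprn_ge0//.
    rewrite -natrX ler_nat; apply: leq_trans (layer_weight_le _ _) _.
    by case: (n) => // n'; rewrite leq_exp2r// ltn_ord.
  rewrite -mulr_sumr ler_wpM2l ?exprn_ge0//.
  have := subrX1 (2 : R) M.+1.
  have -> : 2 - 1 = 1 :> R by lra.
  by rewrite mul1r => <-; rewrite lerBlDr lerDl.
have -> : 2 * 4 ^+ n.+1 * D ^+ n * LlogL n%:R (v / s) =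
    (D * (1 + logplus (v / s))) ^+ n * (2 * (v / sg)).
  rewrite /LlogL powR_mulrn ?addr_ge0// exprMn /sg.
  by field; rewrite expf_neq0// lt0r_neq0.
apply: ler_pM; rewrite ?exprn_ge0//.
  by apply: lerXn2r => //; rewrite nnegrE ?ler0n//; exact: le_trans M_le.
by rewrite exprS ler_wpM2l// ler_pdivlMr// mulrC ltW.
Qed.

End LlogL.

(** * The weak-type upper bound for the rectangles *)

Lemma measure_lty_integral d (T : measurableType d) (R : realType)
    (mu : {measure set T -> \bar R}) (c : R) (g : T -> \bar R) (A : set T) :
  0 < c -> measurable A -> measurable_fun setT g -> (forall x, (0 <= g x)%E) ->
  (forall x, A x -> (c%:E <= g x)%E) -> (\int[mu]_x g x < +oo)%E ->
  (mu A < +oo)%E.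
Proof.
move=> c0 mA mg g0 cg goo.
have cA : (c%:E * mu A <= \int[mu]_x g x)%E.
  rewrite -integral_cst//; apply: (@le_trans _ _ (\int[mu]_(x in A) g x)%E).
    apply: ge0_le_integral => //; last exact: measurable_funTS.
    by move=> x _; rewrite lee_fin ltW.
  exact: ge0_subset_integral.
rewrite ltey; apply: contraTneq (le_lt_trans cA goo) => ->.
by rewrite gt0_muley// ltxx.
Qed.

Section upper_bound.
Variables (R : realType) (n : nat).
Local Notation bl := (borel_lebesgue R n).
Local Notation leb := (lebesgue R n).
Local Notation rn := (n.-tuple (measurableTypeR R)).

Definition exponent (a : n.-1.-tuple int) (i : nat) : int :=
  (rcons a (- \sum_(k <- a) k))`_i.

Lemma translate_rectangle (a : n.-1.-tuple int) (v : Rn R n) :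
  translate v @` rectangle a =
  [set x | forall i : 'I_n, tnth x i \in
    `[tnth v i, tnth v i + 2 ^ exponent a i]].
Proof.
apply/seteqP; split=> [_ [y ay <-] i|x xB].
  have := ay i; rewrite !in_itv/= tnth_mktuple => /andP[y0 y1].
  by rewrite lerDr y0/= addrC lerD2l.
exists [tuple tnth x i - tnth v i | i < n] => [i|].
  have := xB i; rewrite !in_itv/= tnth_mktuple => /andP[y0 y1].
  by rewrite subr_ge0 y0/= lerBlDl.
by apply: eq_from_tnth => i; rewrite !tnth_mktuple subrK.
Qed.

Lemma translate_comp (v w : Rn R n) (Q : set (Rn R n)) :
  translate w @` (translate v @` Q) =
  translate [tuple tnth v i + tnth w i | i < n] @` Q.
Proof.
rewrite image_comp; apply: eq_imagel => x _ /=.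
by apply: eq_from_tnth => i; rewrite !tnth_mktuple addrA.
Qed.

Lemma translate0 (Q : set (Rn R n)) :
  translate [tuple 0 | i < n] @` Q = Q.
Proof.
rewrite -[RHS]image_id; apply: eq_imagel => x _.
by apply: eq_from_tnth => i; rewrite !tnth_mktuple addr0.
Qed.

Lemma mem_rectangles (A : set int) (a : n.-1.-tuple int) (v : Rn R n) :
  (forall j, A (tnth a j)) -> rectangles A (translate v @` rectangle a).
Proof. by move=> Aa M [inv_M sub_M]; apply/inv_M/sub_M; exists a. Qed.

(** The translates of rectangles form a translation-invariant family containing the generators,
    hence contain the smallest one. *)
Lemma rectanglesP (A : set int) (Q : set (Rn R n)) : rectangles A Q ->
  exists a v, Q = translate v @` rectangle a.
Proof.
move=> rQ; apply: (rQ [set Q | exists a v, Q = translate v @` rectangle a]).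
split=> [v _ [a [w ->]]|_ [a _ <-]].
  by exists a, [tuple tnth w i + tnth v i | i < n]; rewrite translate_comp.
by exists a, [tuple 0 | i < n]; rewrite translate0.
Qed.

Lemma inv_lebesgue_box (v : 'I_n -> R) (b : 'I_n -> int) :
  ((leb [set x | forall i, tnth x i \in `[v i, (v i + 2 ^ b i)%R]])^-1 =
   (\prod_(i < n) 2 ^ (- b i))%:E)%E.
Proof.
rewrite lebesgue_box => [|i]; last by rewrite lerDl exprz_ge0.
rewrite (eq_bigr (fun i => 2 ^ b i)) => [|i _]; last by rewrite addrC addKr.
rewrite inver gt_eqF; last by apply: prodr_gt0 => i _; exact: exprz_gt0.
by rewrite -prodfV; congr EFin; apply: eq_bigr => i _; rewrite invr_expz.
Qed.

Lemma maximal_rectangles_le (A : set int) (f : Rn R n -> R) (g : rn -> \bar R) x :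
  measurable_fun setT f -> measurable_fun setT g ->
  (forall y, (0 <= g y)%E) -> (forall y, (`|f y|%:E <= g y)%E) ->
  (maximal (rectangles A) f x <= strong_maximal g x)%E.
Proof.
move=> mf mg g0 fg.
apply: ge_ereal_sup => _ /= [Q [/rectanglesP[a [v ->]] xQ] <-].
rewrite translate_rectangle in xQ *; rewrite inv_lebesgue_box.
apply: le_trans (le_average_strong_maximal mg g0 xQ).
rewrite lee_wpmul2l//; first by rewrite lee_fin prodr_ge0// => i _; exact: exprz_ge0.
have mQ := measurable_box (fun i => `[tnth v i, tnth v i + 2 ^ exponent a i]).
rewrite -integral_lebesgue_borel//.
apply: ge0_le_integral => //.
- exact: measurable_Rn.
- apply/measurable_funTS/measurable_EFinP; exact: measurableT_comp.
- by apply: measurable_funTS; exact: measurable_fun_Rn.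
Qed.

End upper_bound.

(** When the right-hand side is finite, the superlevel sets of [|f|] at positive heights have finite
    measure, so [|f|] has a Borel majorant [g]. Domination everywhere serves the maximal functions,
    equality almost everywhere the integrals. *)
Lemma maximal_rectangles_bounded (R : realType) (n : nat) (A : set int) : (0 < n)%N ->
  bounded_to_weakL1 (@rectangles R n A) (LlogL n.-1%:R).
Proof.
move=> n0.
have [K K0] := layered_le_LlogL R n.-1; rewrite prednK// => HK.
(* The added 1 makes the constant positive, so the bound is trivial when the integral is
   infinite. *)
exists (12 ^+ n * K + 1) => f mf t t0.
set phi := fun x => (LlogL n.-1%:R (`|f x| / t))%:E.
have ft0 x : 0 <= `|f x| / t by rewrite divr_ge0// ltW.
have phi0 x : (0 <= phi x)%E.
  by rewrite lee_fin (le_trans (ft0 x))// le_LlogL.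
have mF : measurable_fun setT (fun x => `|f x|) by exact: measurableT_comp.
have mphi : measurable_fun setT phi.
  apply/measurable_EFinP; apply: (measurableT_comp (measurable_LlogL n.-1%:R)).
  exact: (measurable_funM mF (measurable_cst _)).
have C0 : 0 < 12 ^+ n * K + 1 by rewrite ltr_wpDl// mulr_ge0// exprn_ge0.
have [->|] := eqVneq (\int[lebesgue R n]_x phi x)%E +oo%E.
  by rewrite gt0_muley ?leey// lte_fin.
rewrite -ltey => phioo.
have mA q : measurable [set x : Rn R n | q < `|f x|].
  rewrite -[X in measurable X]setTI.
  have mEf : measurable_fun setT (EFin \o (fun x => `|f x|)).
    exact/measurable_EFinP.
  exact: (emeasurable_fun_o_infty measurableT mEf q%:E).
have Aoo q : 0 < q -> (lebesgue R n [set x | (q < `|f x|)%R] < +oo)%E.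
  move=> q0.
  apply: (measure_lty_integral (c := q / t) (g := phi)) => //.
    by rewrite divr_gt0.
  move=> x /= qf; rewrite lee_fin; apply: le_trans (le_LlogL _ (ft0 x)) => //.
  by rewrite ler_pM2r ?invr_gt0// ltW.
have [g [mg g0 fg gf]] := borel_majorant mF (fun x => normr_ge0 _) Aoo.
have mgR := measurable_fun_Rn mg.
set S := [set x | (t%:E < strong_maximal g x)%E].
have mS : measurable S.
  rewrite -[X in measurable X]setTI; apply: emeasurable_fun_o_infty => //.
  exact: measurable_strong_maximal.
apply: (@le_trans _ _ (borel_lebesgue R n S)).
  rewrite -lebesgue_borelE//; apply: le_lebesgue => x /= /lt_le_trans; apply.
  exact: maximal_rectangles_le.
apply: le_trans (weak_type_strong_maximal t0 mg g0) _.
have mL := measurable_layered n (t / 4 ^+ n) mg.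
rewrite -integral_lebesgue_borel//; last by move=> x; exact: layered_ge0.
have LK : (\int[lebesgue R n]_x layered n (t / 4 ^+ n) (g x) <=
    K%:E * \int[lebesgue R n]_x phi x)%E.
  rewrite -ge0_integralZl//.
  have mKphi : measurable_fun setT (fun x => K%:E * phi x)%E.
    by apply: measurable_funeM; exact: mphi.
  have Kphi0 x : (0 <= K%:E * phi x)%E by apply: mule_ge0; [rewrite lee_fin|exact: phi0].
  apply: (ae_ge0_le_integral measurableT _ (measurable_fun_Rn mL) _ mKphi).
  - by move=> x _; exact: layered_ge0.
  - by move=> x _; exact: Kphi0.
  apply: negligibleS gf => x /=; apply: contra_not => gfx _.
  have -> : g x = `|f x|%:E by apply/eqP; rewrite eq_le gfx fg.
  by rewrite -EFinM; apply: HK.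
apply: le_trans (lee_wpmul2l _ LK) _; first by rewrite lee_fin exprn_ge0.
rewrite muleA -EFinM; apply: lee_wpmul2r; first exact: integral_ge0.
by rewrite lee_fin lerDl.
Qed.

(** * Sets of small density and their n-fold products *)

Lemma divz_eqP (f w : int) (N : nat) : (0 < N)%N ->
  (f %/ N)%Z = w <-> exists2 i : nat, (i < N)%N & f = w * N + i.
Proof.
move=> N0; have N0' : (N : int) != 0 by rewrite -lt0n.
split=> [<-|[i iN ->]].
  exists (absz (f %% N)%Z).
    by have := ltz_pmod f (_ : 0 < N :> int); have := modz_ge0 f N0'; lia.
  by rewrite gez0_abs ?modz_ge0// -divz_eq.
by rewrite divzMDl// divz_small ?addr0// absz_nat.
Qed.

Section dyadic_comb.
Variable R : realType.
Local Notation mu := (@lebesgue_measure R).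
Implicit Types (q z : int) (x y : R).

(** Defining the intervals by [floor] turns their nesting and subdivision into integer division. *)
Definition dyadic q z : set R := [set x | Num.floor (x / 2 ^ q) = z].

Lemma dyadicE q z : dyadic q z = `[z%:~R * 2 ^ q, (z%:~R + 1) * 2 ^ q[%classic.
Proof.
have q0 : 0 < (2 : R) ^ q by rewrite exprz_gt0.
apply/seteqP; split=> x; rewrite /dyadic/= in_itv/=.
  move=> <-; rewrite -ler_pdivlMr// -ltr_pdivrMr//.
  by have := floor_itv (x / 2 ^ q); rewrite intrD.
by move=> xz; apply: floor_def; rewrite intrD ler_pdivlMr// ltr_pdivrMr.
Qed.

Lemma measurable_dyadic q z : measurable (dyadic q z).
Proof. by rewrite dyadicE; exact: measurable_itv. Qed.

Lemma lebesgue_measure_dyadic q z : mu (dyadic q z) = (2 ^ q)%:E.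
Proof.
rewrite dyadicE lebesgue_measure_itv/= lte_fin ltr_pM2r ?exprz_gt0// ltrDl ltr01.
by rewrite -EFinB; congr EFin; ring.
Qed.

(** Both sides are integers with the same integers below them. *)
Lemma floor_divn x (N : nat) : (0 < N)%N ->
  Num.floor (x / N%:R) = (Num.floor x %/ N)%Z.
Proof.
move=> N0; have N0' : (0 : R) < N%:R by rewrite ltr0n.
have H (m : int) : (m <= Num.floor (x / N%:R)) = (m <= (Num.floor x %/ N)%Z).
  rewrite floor_ge_int ler_pdivlMr// lez_divRL; last by rewrite ltz_nat.
  by rewrite floor_ge_int intrM.
by apply/eqP; rewrite eq_le -H lexx H lexx.
Qed.

Lemma floor_dyadicD x q (e : nat) :
  Num.floor (x / 2 ^ (q + e%:Z)) = (Num.floor (x / 2 ^ q) %/ (2 ^ e)%N)%Z.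
Proof.
rewrite -floor_divn ?expn_gt0// expfzDr ?pnatr_eq0// invfM mulrA natrX.
by rewrite -exprnP.
Qed.

Lemma floor_dyadic_eq x y q q' : q <= q' ->
  Num.floor (x / 2 ^ q) = Num.floor (y / 2 ^ q) ->
  Num.floor (x / 2 ^ q') = Num.floor (y / 2 ^ q').
Proof.
move=> qq' xy; have [e ->] : exists e : nat, q' = q + e%:Z.
  by exists (absz (q' - q)%R); lia.
by rewrite !floor_dyadicD xy.
Qed.

(* The points whose binary digit of weight [2 ^ (q - 1)] is zero. *)
Definition digit0 q : set R := [set x | (2 %| Num.floor (x / 2 ^ (q - 1)))%Z].

Variable p : nat -> int.
Hypothesis p_incr : forall j, p j < p j.+1.

Let p_le i j : (i <= j)%N -> p i <= p j.
Proof.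
move=> /subnKC <-; elim: (j - i)%N => [|e IHe]; first by rewrite addn0.
by rewrite addnS (le_trans IHe)// ltW.
Qed.

Definition thinned k m : set R :=
  [set x | forall j, (k < j <= m)%N -> digit0 (p j) x].

Lemma measurable_thinned k m : measurable (thinned k m).
Proof.
have -> : thinned k m =
    \bigcap_(j in [set j | (k < j <= m)%N]) digit0 (p j) by [].
apply: bigcap_measurableType => j _.
have -> : digit0 (p j) = \bigcup_z dyadic (p j - 1) (2 * z).
  apply/seteqP; split=> x /= => [/dvdzP[z xz]|[z _ xz]].
    by exists z => //; rewrite /dyadic/= xz mulrC.
  by rewrite /digit0/= xz dvdz_mulr.
apply: countable_bigcupT_measurable; first exact: countableP.
by move=> z; exact: measurable_dyadic.
Qed.

Lemma thinnedS k m : (k <= m)%N ->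
  thinned k m.+1 = digit0 (p m.+1) `&` thinned k m.
Proof.
move=> km; apply/seteqP; split=> x.
  move=> xk; split=> [|j /andP[kj jm]]; first by apply: xk; rewrite ltnS km leqnn.
  by apply: xk; rewrite kj leqW.
move=> [xm xk] j /andP[kj]; rewrite leq_eqVlt => /predU1P[->//|jm].
by apply: xk; rewrite kj.
Qed.

Lemma thinned_nil k : thinned k k = setT.
Proof.
by apply/seteqP; split=> // x _ j /andP[kj jk]; have := leq_trans kj jk; rewrite ltnn.
Qed.

(** Each new digit condition keeps the lower half of the interval, and that half splits into
    intervals of the preceding scale, to which induction applies. Every scale thus halves the
    density. *)
Lemma lebesgue_measure_dyadic_thinned k e z :
  mu (dyadic (p (k + e)) z `&` thinned k (k + e)) =
  (2 ^ (p (k + e)%N) / 2 ^+ e)%:E.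
Proof.
elim: e z => [|e IHe] z.
  by rewrite addn0 thinned_nil setIT lebesgue_measure_dyadic expr0 divr1.
rewrite addnS thinnedS ?leq_addr//; set m := (k + e)%N in IHe *.
have N_gt0 l : (0 < 2 ^ l)%N by rewrite expn_gt0.
have [l pE] : exists l : nat, p m.+1 - 1 = p m + l%:Z.
  by exists (absz (p m.+1 - 1 - p m)%R); have := p_incr m; lia.
have pE' : p m.+1 = p m.+1 - 1 + 1%:Z by rewrite subrK.
(* The lower half is the interval of index [2 * z] at scale [p m.+1 - 1], which contains [2 ^ l]
   intervals of scale [p m]. *)
pose F (i : nat) := dyadic (p m) (2 * z * (2 ^ l)%N + i) `&` thinned k m.
have -> : dyadic (p m.+1) z `&` (digit0 (p m.+1) `&` thinned k m) =
    \big[setU/set0]_(i < 2 ^ l) F i.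
  rewrite -bigcup_mkord setIA; under [RHS]eq_bigcupr do rewrite /F.
  rewrite -setI_bigcupl; congr (_ `&` _).
  apply/seteqP; split=> x.
    rewrite /dyadic/digit0/= {1}pE' floor_dyadicD pE floor_dyadicD expn1.
    set f := Num.floor _ => -[fz /dvdzP[w fw]].
    have {fw} /(divz_eqP _ _ (N_gt0 l))[i iN fi] : (f %/ (2 ^ l)%N)%Z = 2 * z.
      by lia.
    by exists i.
  rewrite /dyadic/digit0/= {1}pE' floor_dyadicD pE floor_dyadicD expn1.
  set f := Num.floor _ => -[i iN fi].
  have fz : (f %/ (2 ^ l)%N)%Z = 2 * z by apply/(divz_eqP _ _ (N_gt0 l)); exists i.
  by rewrite fz mulrC mulzK// dvdz_mull.
rewrite measure_bigsetU; last 2 first.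
- move=> i; apply: measurableI; first exact: measurable_dyadic.
  exact: measurable_thinned.
- apply/trivIsetP => i j _ _ ij; apply/seteqP; split=> // x [[/= xi _] [/= xj _]].
  by move/eqP: ij; apply; move: xi; rewrite /dyadic/= xj; lia.
rewrite (eq_bigr (fun=> (2 ^ p m / 2 ^+ e)%:E)) => [|i _]; last exact: IHe.
rewrite sumEFin sumr_const card_ord -(mulr_natl _ (2 ^ l)%N) natrX; congr EFin.
rewrite pE' pE !expfzDr ?pnatr_eq0// exprS -!exprnP expr1.
by field; rewrite expf_neq0.
Qed.

Lemma lebesgue_measure_dyadic_thinned_le k m z : (k <= m)%N ->
  mu (dyadic (p m) z `&` thinned k m) = (2 ^ p m / 2 ^+ (m - k))%:E.
Proof. by move=> /subnKC <-; rewrite lebesgue_measure_dyadic_thinned addKn. Qed.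

Variable m : nat.

(* The finite stages of a Cantor-like construction in [0, 2 ^ p m[: [comb k] is a
   union of dyadic intervals of length [2 ^ p k]. *)
Definition comb k : set R := dyadic (p m) 0 `&` thinned k m.

Lemma measurable_comb k : measurable (comb k).
Proof.
by apply: measurableI; [exact: measurable_dyadic|exact: measurable_thinned].
Qed.

Lemma lebesgue_measure_comb k : (k <= m)%N ->
  mu (comb k) = (2 ^ p m / 2 ^+ (m - k))%:E.
Proof. exact: lebesgue_measure_dyadic_thinned_le. Qed.

Lemma comb_subset i j : (i <= j)%N -> comb i `<=` comb j.
Proof.
move=> ij x [x0 xi]; split=> // l /andP[jl lm]; apply: xi.
by rewrite lm (leq_ltn_trans ij).
Qed.

(** On the dyadic interval of scale [p k] around [x], the conditions of index above [k] hold because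
    they hold at [x]. Only the [k] lower ones restrict [comb 0] there, each halving the density. *)
Lemma comb_density k x : (k <= m)%N -> comb k x -> exists2 a : R,
  x \in `[a, a + 2 ^ p k] &
  ((2 ^ p k / 2 ^+ k)%:E <= mu (`[a, (a + 2 ^ p k)%R] `&` comb 0))%E.
Proof.
move=> km [x0 xk]; set z := Num.floor (x / 2 ^ p k).
have zE : dyadic (p k) z `<=` `[z%:~R * 2 ^ p k, z%:~R * 2 ^ p k + 2 ^ p k]%classic.
  rewrite dyadicE => y /=; rewrite !in_itv/= mulrDl mul1r => /andP[-> /ltW].
  by [].
exists (z%:~R * 2 ^ p k); first exact: zE.
have <- : mu (dyadic (p k) z `&` thinned 0 k) = (2 ^ p k / 2 ^+ k)%:E.
  by rewrite lebesgue_measure_dyadic_thinned_le// subn0.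
apply: le_measure; rewrite ?inE.
- by apply: measurableI; [exact: measurable_dyadic|exact: measurable_thinned].
- by apply: measurableI; [exact: measurable_itv|exact: measurable_comb].
move=> y [yz yk]; split; first exact: zE.
split.
  by rewrite /dyadic/= (floor_dyadic_eq (p_le km) yz).
move=> j /andP[j0 jm]; have [jk|kj] := leqP j k; first by apply: yk; rewrite j0.
(* For [j > k] the tested digit belongs to the scale [p j - 1 >= p k], so all points of the interval
   share it. *)
rewrite /digit0/= (@floor_dyadic_eq y x (p k))//; first by apply: xk; rewrite kj.
have := p_incr j.-1; rewrite prednK// => pj.
have : p k <= p j.-1 by apply: p_le; rewrite -ltnS prednK.
lia.
Qed.

Definition comb_shell k : set R :=
  comb k `\` (if k is k'.+1 then comb k' else set0).

Lemma measurable_comb_shell k : measurable (comb_shell k).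
Proof.
apply: measurableD; first exact: measurable_comb.
by case: k => // k; exact: measurable_comb.
Qed.

Lemma comb_shell_disjoint i j x : comb_shell i x -> comb_shell j x -> i = j.
Proof.
wlog ij : i j / (i <= j)%N.
  by move=> H; case/orP: (leq_total i j) => /H//; move=> + /[swap] => /[apply]/[apply].
move=> [xi _]; case: j ij => [|j]; first by rewrite leqn0 => /eqP.
rewrite leq_eqVlt ltnS => /predU1P[//|ij [_ /=]].
by have := comb_subset ij xi.
Qed.

(** [comb k.+1] has twice the measure of [comb k], so removing the latter leaves half; at level 0
    nothing is removed. *)
Lemma lebesgue_measure_comb_shell k : (k <= m)%N ->
  ((2 ^ p m / 2 ^+ (m - k) / 2)%:E <= mu (comb_shell k))%E.
Proof.
move=> km.
have p0 i : 0 <= (2 : R) ^ p m / 2 ^+ i by rewrite divr_ge0 ?exprz_ge0 ?exprn_ge0.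
have mk0 := lebesgue_measure_comb km.
rewrite /comb_shell measureD; last 3 first.
- exact: measurable_comb.
- by case: (k) => // k'; exact: measurable_comb.
- by rewrite -[ltLHS]/(mu (comb k)) mk0 ltry.
case: k km mk0 => [|k] km mk0.
  rewrite setI0 measure0 sube0 -[leRHS]/(mu (comb 0)) mk0 lee_fin.
  by rewrite ler_pdivrMr// ler_peMr// ler1n.
rewrite setIidr; last exact: comb_subset.
rewrite -[leRHS]/(mu (comb k.+1) - mu (comb k))%E mk0.
rewrite (lebesgue_measure_comb (ltnW km)) -EFinB lee_fin.
rewrite -(subnSK km) exprS invfM.
have := p0 (m - k.+1)%N; set P := 2 ^ p m; set Q := _^-1.
rewrite mulrCA; lra.
Qed.

End dyadic_comb.

Lemma measure_disjoint_family_ge d (T : measurableType d) (R : realType)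
    (mu : {measure set T -> \bar R}) (I : eqType) (s : seq I) (D : I -> set T)
    (c : R) :
  uniq s -> (forall i, measurable (D i)) ->
  (forall i j x, D i x -> D j x -> i = j) ->
  (forall i, i \in s -> (c%:E <= mu (D i))%E) ->
  (((size s)%:R * c)%:E <= mu (\bigcup_(i in [set` s]) D i))%E.
Proof.
move=> + mD djD; elim: s => [_ _|i s IHs]; first by rewrite mul0r.
move=> /= /andP[si us] cD.
have mU : measurable (\bigcup_(j in [set` s]) D j).
  by apply: fin_bigcup_measurable => // j _; exact: mD.
have -> : \bigcup_(j in [set` i :: s]) D j =
    D i `|` \bigcup_(j in [set` s]) D j.
  apply/seteqP; split=> x [].
    move=> j /=; rewrite inE => /predU1P[->|js] Djx; first by left.
    by right; exists j.
  - by move=> Dix; exists i => //=; rewrite inE eqxx.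
  - by move=> [j /= js Djx]; exists j => //=; rewrite inE js orbT.
rewrite measureU//; last first.
  apply/seteqP; split=> // x [Dix [j /= js Djx]].
  by move: si; rewrite (djD _ _ _ Dix Djx) js.
rewrite -natr1 mulrDl mul1r addrC EFinD; apply: leeD.
  by apply: cD; rewrite inE eqxx.
by apply: IHs => // j js; apply: cD; rewrite inE js orbT.
Qed.

Section product_sets.
Variable R : realType.
Local Notation mu := (@lebesgue_measure R).
Local Notation bl := (borel_lebesgue R).
Local Notation rn n := (n.-tuple (measurableTypeR R)).

Definition prod_set n (S : 'I_n -> set R) : set (rn n) :=
  [set x | forall i, S i (tnth x i)].

Lemma measurable_prod_set n (S : 'I_n -> set R) : (forall i, measurable (S i)) ->
  measurable (prod_set S).
Proof.
move=> mS.
have -> : prod_set S = \bigcap_(j in setT) ((fun x => tnth x j) @^-1` S j).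
  by apply/seteqP; split=> x /= xS i; [move=> _; exact: xS|exact: xS].
apply: fin_bigcap_measurable => // j _; rewrite -[X in measurable X]setTI.
by apply: measurable_tnth => //; exact: mS.
Qed.

Lemma borel_lebesgue_prod_set n (S : 'I_n -> set R) (c : 'I_n -> R) :
  (forall i, measurable (S i)) -> (forall i, mu (S i) = (c i)%:E) ->
  bl n (prod_set S) = (\prod_(i < n) c i)%:E.
Proof.
elim: n S c => [|n IHn] S c mS muS /=.
  by rewrite big_ord0 diracE mem_set// => -[].
rewrite /cons_measure /pushforward.
have -> : @cons_pair R n @^-1` prod_set S =
    S ord0 `*` prod_set (fun i => S (lift ord0 i)).
  apply/seteqP; split=> -[x y] /=.
    move=> xy; split; first by have := xy ord0; rewrite tnth0.
    by move=> j; have := xy (lift ord0 j); rewrite tnthS.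
  move=> [xi yi] j; case: (unliftP ord0 j) => [k|] ->; last by rewrite tnth0.
  by rewrite tnthS; exact: yi.
rewrite product_measure2E; [|exact: mS|by apply: measurable_prod_set => i; exact: mS].
rewrite (IHn _ (fun i => c (lift ord0 i)))//.
by rewrite [X in (X * _)%E]muS big_ord_recl EFinM.
Qed.

End product_sets.

(** * The lower bound from long arithmetic progressions *)

Lemma sum_nth_rcons (n : nat) (s : seq nat) (y : nat) (F : nat -> nat) :
  (size s).+1 = n ->
  (\sum_(i < n) F (nth 0 (rcons s y) i) = \sum_(x <- s) F x + F y)%N.
Proof.
move=> <-; rewrite -(size_rcons s y).
rewrite -(big_mkord xpredT (fun i => F (nth 0 (rcons s y) i)%N)).
have -> : (\sum_(x <- s) F x + F y = \sum_(x <- rcons s y) F x)%N.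
  by rewrite -cats1 big_cat big_seq1.
by rewrite [RHS](big_nth 0%N).
Qed.

Section lower_bound.
Variables (R : realType) (n : nat) (A : set int) (m : nat) (u : nat -> int).
Hypotheses (n_gt1 : (1 < n)%N) (m_gt0 : (0 < m)%N).
Hypothesis uA : forall k, (k < m.+1)%N -> A (u k).
Hypothesis u_step : 0 < u 1%N - u 0%N.
Hypothesis uE : forall k, (k < m.+1)%N -> u k = u 0%N + k%:Z * (u 1%N - u 0%N).
Local Notation mu := (@lebesgue_measure R).
Local Notation bl := (borel_lebesgue R n).
Local Notation leb := (lebesgue R n).
Local Notation rn := (n.-tuple (measurableTypeR R)).
Local Notation K := (m %/ n.-1)%N.
Local Notation steps := (n.-1.-tuple 'I_K.+1).

(** The first [n.-1] levels are free and the last one brings the sum to [m]; the bound [K] on each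
    free level keeps the truncated subtraction exact. *)
Definition level (k : steps) (i : nat) : nat :=
  nth 0 (rcons (map val k) (m - \sum_(j <- map val k) j)%N) i.

(** The last progression is arranged to increase with [j] as well, and to equal minus the sum of the
    other exponents as soon as the levels add up to [m]. *)
Definition side_exponent (i : nat) (j : nat) : int :=
  if (i < n.-1)%N then u 0%N + j%:Z * (u 1%N - u 0%N)
  else - (u 0%N *+ n.-1 + (m%:Z - j%:Z) * (u 1%N - u 0%N)).

Lemma side_exponent_incr i j : side_exponent i j < side_exponent i j.+1.
Proof.
rewrite /side_exponent; move: u_step; set d := _ - _ => d_gt0.
by case: ifP => _; nia.
Qed.

Definition progression_exponents (k : steps) : n.-1.-tuple int :=
  [tuple u (tnth k j) | j < n.-1].

Lemma sum_steps_le (k : steps) : (\sum_(j <- map val k) j <= m)%N.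
Proof.
rewrite big_map; apply: (@leq_trans (\sum_(j <- k) K)).
  by apply: leq_sum => j _; exact: (ltn_ord j).
rewrite big_const_seq count_predT size_tuple iter_addn_0.
exact: leq_divM.
Qed.

Lemma level_le (k : steps) i : (level k i <= m)%N.
Proof.
rewrite /level nth_rcons; case: ifP => [ik|_]; last first.
  by case: ifP => _ //; exact: leq_subr.
have : nth 0%N (map val k) i \in map val k by exact: mem_nth.
move=> /mapP[j _ ->]; rewrite -ltnS (leq_trans (ltn_ord j))// ltnS.
exact: leq_div.
Qed.

Lemma exponentE (k : steps) (i : nat) : (i < n)%N ->
  exponent (progression_exponents k) i = side_exponent i (level k i).
Proof.
move=> i_lt; rewrite /exponent /level /side_exponent !nth_rcons size_map !size_tuple.
case: ifPn => [iN|].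
  rewrite (nth_map (tnth_default k (Ordinal iN)))// ?size_tuple//.
  rewrite -(tnth_nth 0 (progression_exponents k) (Ordinal iN)) tnth_mktuple.
  rewrite -(tnth_nth _ k (Ordinal iN)) uE//.
  by apply: leq_trans (ltn_ord _) _; rewrite ltnS leq_div.
rewrite -leqNgt => Ni.
have -> : i = n.-1 by lia.
rewrite eqxx; congr (- _).
rewrite -[in RHS]subzn; last exact: sum_steps_le.
rewrite subKr big_tuple.
rewrite (eq_bigr (fun j : 'I_n.-1 => u 0%N + (tnth k j : nat)%:Z *
    (u 1%N - u 0%N))); last first.
  move=> j _; rewrite tnth_mktuple uE//.
  by apply: leq_trans (ltn_ord _) _; rewrite ltnS leq_div.
rewrite big_split/= sumr_const card_ord -mulr_suml; congr (_ + _ * _).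
by rewrite big_map big_tuple -natz natr_sum; under eq_bigr do rewrite natz.
Qed.

Lemma sum_level (k : steps) : (\sum_(i < n) level k i = m)%N.
Proof.
rewrite (sum_nth_rcons _ id); first by rewrite subnKC// sum_steps_le.
by rewrite size_map size_tuple; lia.
Qed.

Lemma sum_colevel (k : steps) : (\sum_(i < n) (m - level k i) = m * n.-1)%N.
Proof.
apply: (@addnI m); rewrite -{1}(sum_level k) -big_split/=.
rewrite (eq_bigr (fun=> m)) => [|i _]; last by rewrite subnKC// level_le.
by rewrite sum_nat_const card_ord -mulnS mulnC; congr (_ * _)%N; lia.
Qed.

Definition comb_box : set rn :=
  prod_set (fun i : 'I_n => @comb R (side_exponent i) m 0).

Definition shell_box (k : steps) : set rn :=
  prod_set (fun i : 'I_n => @comb_shell R (side_exponent i) m (level k i)).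

Let top : R := \prod_(i < n) 2 ^ side_exponent i m.

Let top_gt0 : 0 < top.
Proof. by apply: prodr_gt0 => i _; rewrite exprz_gt0. Qed.

Lemma measurable_comb_box : measurable comb_box.
Proof. by apply: measurable_prod_set => i; exact: measurable_comb. Qed.

Lemma measurable_shell_box k : measurable (shell_box k).
Proof. by apply: measurable_prod_set => i; exact: measurable_comb_shell. Qed.

Lemma borel_lebesgue_comb_box : bl comb_box = (top / 2 ^+ (m * n))%:E.
Proof.
rewrite (borel_lebesgue_prod_set
  (c := fun i : 'I_n => 2 ^ side_exponent i m / 2 ^+ m)).
- rewrite big_split/= prodfV prodrXr sum_nat_const card_ord.
  by rewrite (mulnC n).
- by move=> i; exact: measurable_comb.
- move=> i; rewrite lebesgue_measure_comb ?subn0//.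
  exact: side_exponent_incr.
Qed.

Lemma le_prod_set_measure (S : 'I_n -> set R) (c : 'I_n -> R) :
  (forall i, measurable (S i)) -> (forall i, (mu (S i) < +oo)%E) ->
  (forall i, 0 <= c i) -> (forall i, ((c i)%:E <= mu (S i))%E) ->
  ((\prod_(i < n) c i)%:E <= bl (prod_set S))%E.
Proof.
move=> mS Soo c0 cS.
have Sfin i : mu (S i) \is a fin_num by rewrite ge0_fin_numE.
rewrite (borel_lebesgue_prod_set (c := fun i => fine (mu (S i))))//; last first.
  by move=> i; rewrite fineK.
rewrite lee_fin; apply: ler_prod => i _.
by rewrite c0 -lee_fin fineK// cS.
Qed.

(** By [sum_colevel] the bound is the same for every [k]: it is [2 ^+ m] times the measure of
    [comb_box], with a factor 1/2 lost to the shell in each coordinate. *)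
Lemma borel_lebesgue_shell_box k :
  ((top / 2 ^+ (m * n.-1) / 2 ^+ n)%:E <= bl (shell_box k))%E.
Proof.
have -> : top / 2 ^+ (m * n.-1) / 2 ^+ n =
    \prod_(i < n) (2 ^ side_exponent i m / 2 ^+ (m - level k i) / 2).
  rewrite !big_split/= prodfV prodrXr sum_colevel prodr_const card_ord.
  by rewrite exprVn.
apply: le_prod_set_measure => i.
- exact: measurable_comb_shell.
- apply: (@le_lt_trans _ _ (mu (@comb R (side_exponent i) m (level k i)))).
    apply: le_measure; rewrite ?inE.
    + exact: measurable_comb_shell.
    + exact: measurable_comb.
    + exact: subDsetl.
  by rewrite lebesgue_measure_comb ?ltry ?level_le//; exact: side_exponent_incr.
- by rewrite !divr_ge0 ?exprz_ge0 ?exprn_ge0.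
- apply: lebesgue_measure_comb_shell; last exact: level_le.
  exact: side_exponent_incr.
Qed.

(** The shells containing the first [n.-1] coordinates already determine [k]. *)
Lemma shell_box_disjoint k k' x : shell_box k x -> shell_box k' x -> k = k'.
Proof.
move=> xk xk'; apply: eq_from_tnth => j; apply/val_inj.
have jn : (j < n)%N by have := ltn_ord j; lia.
have := comb_shell_disjoint (xk (Ordinal jn)) (xk' (Ordinal jn)).
rewrite /level !nth_rcons !size_map !size_tuple/= (ltn_ord j).
by rewrite !(nth_map (tnth_default k j)) ?size_tuple// -!tnth_nth.
Qed.

(** The intervals given by [comb_density] in the separate coordinates multiply to a translated
    rectangle of the family, and their densities to [2 ^- m], since the levels sum to [m]. *)
Lemma maximal_comb_box_ge k x : shell_box k x ->
  ((2 ^- m)%:E <= maximal (rectangles A) (\1_comb_box : Rn R n -> R) x)%E.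
Proof.
move=> xk; pose b (i : 'I_n) := side_exponent i (level k i).
have dens (i : 'I_n) : exists a : R, tnth x i \in `[a, a + 2 ^ b i] /\
  ((2 ^ b i / 2 ^+ level k i)%:E <=
    mu (`[a, (a + 2 ^ b i)%R] `&` @comb R (side_exponent i) m 0))%E.
  have [xi _] := xk i.
  have [a ax ad] := comb_density (@side_exponent_incr i) (level_le k i) xi.
  by exists a.
have [a /all_and2[xa ad]] := choice dens.
pose v : Rn R n := [tuple a i | i < n].
pose Q := [set x : rn | forall i, tnth x i \in `[a i, a i + 2 ^ b i]].
have QE : translate v @` rectangle (progression_exponents k) = Q.
  rewrite translate_rectangle; apply/seteqP; split=> y yQ i; have := yQ i;
  by rewrite tnth_mktuple exponentE.
have progA j : A (tnth (progression_exponents k) j).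
  rewrite tnth_mktuple; apply: uA; apply: leq_trans (ltn_ord _) _.
  by rewrite ltnS leq_div.
have BQ := mem_rectangles v progA.
apply: le_trans (ereal_sup_ubound _); last first.
  exists (translate v @` rectangle (progression_exponents k)) => //.
  by split; [exact: BQ|rewrite QE => i; exact: xa].
rewrite QE inv_lebesgue_box.
have mQ : measurable Q := measurable_box (fun i => `[a i, a i + 2 ^ b i]).
have mE := measurable_comb_box.
rewrite (eq_integral (fun y : Rn R n => (\1_comb_box y : R)%:E)); last first.
  by move=> y _; rewrite ger0_norm// indicE.
rewrite integral_indic; [|exact: measurable_Rn|exact: measurable_Rn].
rewrite lebesgue_borelE; last exact: measurableI.
have -> : comb_box `&` Q = prod_set (fun i : 'I_n =>
    `[a i, a i + 2 ^ b i]%classic `&` @comb R (side_exponent i) m 0).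
  apply/seteqP; split=> [y [yE yQ] i|y yEQ].
    by split; [exact: yQ|exact: yE].
  by split=> i; case: (yEQ i).
apply: (@le_trans _ _ ((\prod_(i < n) 2 ^ (- b i))%:E *
    (\prod_(i < n) (2 ^ b i / 2 ^+ level k i))%:E)%E).
  rewrite -EFinM -big_split/= lee_fin.
  rewrite (eq_bigr (fun i : 'I_n => (2 ^+ level k i)^-1)); last first.
    by move=> i _; rewrite mulrA -expfzDr ?pnatr_eq0// addNr expr0z mul1r.
  by rewrite prodfV prodrXr sum_level.
apply: lee_wpmul2l.
  by rewrite lee_fin prodr_ge0// => i _; rewrite exprz_ge0.
apply: le_prod_set_measure => i.
- by apply: measurableI; [exact: measurable_itv|exact: measurable_comb].
- apply: (@le_lt_trans _ _ (mu (@comb R (side_exponent i) m 0))).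
    apply: le_measure; rewrite ?inE.
    + by apply: measurableI; [exact: measurable_itv|exact: measurable_comb].
    + exact: measurable_comb.
    + exact: subIsetr.
  by rewrite lebesgue_measure_comb ?ltry//; exact: side_exponent_incr.
- by rewrite !divr_ge0 ?exprz_ge0 ?exprn_ge0.
- exact: ad.
Qed.

(** There are [K.+1 ^ n.-1] disjoint shell boxes of equal lower bound, which gives the power of
    [m]. *)
Lemma maximal_comb_box_lower :
  (((2 ^- n * n.-1%:R ^- n.-1) * m%:R ^+ n.-1 * 2 ^+ m)%:E * leb comb_box <=
   leb [set x | ((2 ^- m)%:E <=
     maximal (rectangles A) (\1_comb_box : Rn R n -> R) x)%E])%E.
Proof.
have n1_gt0 : (0 < n.-1)%N by lia.
have mU : measurable (\bigcup_(k in [set` enum {: steps}]) shell_box k).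
  by apply: fin_bigcup_measurable => // k _; exact: measurable_shell_box.
apply: (@le_trans _ _ (bl (\bigcup_(k in [set` enum {: steps}]) shell_box k)));
    last first.
  rewrite -lebesgue_borelE//; apply: le_lebesgue => x [k _ xk] /=.
  exact: maximal_comb_box_ge xk.
rewrite lebesgue_borelE; last exact: measurable_comb_box.
rewrite borel_lebesgue_comb_box.
apply: le_trans (measure_disjoint_family_ge (enum_uniq _) measurable_shell_box
  shell_box_disjoint (fun k _ => borel_lebesgue_shell_box k)).
rewrite -EFinM lee_fin -cardE card_tuple card_ord natrX.
have N0 : (0 : R) < n.-1%:R by rewrite ltr0n.
(* Euclidean division gives [m < K.+1 * n.-1]. *)
have mK : (m%:R : R) ^+ n.-1 <= n.-1%:R ^+ n.-1 * K.+1%:R ^+ n.-1.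
  rewrite -exprMn lerXn2r ?nnegrE ?mulr_ge0// -natrM ler_nat mulnC.
  exact/ltnW/ltn_ceil.
have -> : (m * n = m + m * n.-1)%N by rewrite -mulnS prednK// ltnW.
rewrite exprD.
have -> : 2 ^- n * n.-1%:R ^- n.-1 * m%:R ^+ n.-1 * 2 ^+ m *
    (top / (2 ^+ m * 2 ^+ (m * n.-1))) =
    (m%:R ^+ n.-1 / n.-1%:R ^+ n.-1) * (top / 2 ^+ (m * n.-1) / 2 ^+ n).
  by field; rewrite !expf_neq0//= lt0r_neq0.
apply: ler_wpM2r.
  by rewrite !divr_ge0 ?exprn_ge0// (ltW top_gt0).
by rewrite ler_pdivrMr ?exprn_gt0// mulrC.
Qed.

End lower_bound.

Lemma maximal_rectangles_lower (R : realType) (n : nat) (A : set int) (m : nat) :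
  (1 < n)%N -> has_long_progressions A -> (0 < m)%N ->
  exists E : set (Rn R n),
    [/\ measurable E, (0 < lebesgue R n E < +oo)%E &
        ((2 ^- n * n.-1%:R ^- n.-1 * m%:R ^+ n.-1 * 2 ^+ m)%:E *
           lebesgue R n E <=
         lebesgue R n
           [set x | (2 ^- m)%:E <= maximal (@rectangles R n A) \1_E x])%E].
Proof.
(* A progression of [m.+1] terms provides the indices 0 to [m], and at least two terms, hence a
   positive step. *)
move=> n1 /(_ m.+1 isT)[u [uA u_mono uE]] m0.
have u_step : 0 < u 1%N - u 0%N by rewrite subr_gt0; exact: u_mono.
have mE := @measurable_comb_box R n m u.
exists (@comb_box R n m u); split.
- exact: measurable_Rn.
- rewrite lebesgue_borelE// borel_lebesgue_comb_box// ltry lte_fin andbT.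
  by rewrite divr_gt0 ?exprn_gt0// prodr_gt0// => i _; rewrite exprz_gt0.
- exact: maximal_comb_box_lower.
Qed.

(** * Sharpness among Orlicz spaces *)

Section sharpness.
Variables (R : realType) (N : nat).

(** Since [ln 2 <= 1], the logarithmic factor is at most [m + 2 <= 3 * m]. *)
Lemma LlogL_pow2_le (m : nat) : (0 < m)%N ->
  LlogL N%:R (2 ^+ m.+1) <= 2 * 3 ^+ N * (m%:R ^+ N * 2 ^+ m) :> R.
Proof.
move=> m0; rewrite /LlogL powR_mulrn ?addr_ge0 ?logplus_ge0//.
have -> : 2 * 3 ^+ N * (m%:R ^+ N * 2 ^+ m) = 2 ^+ m.+1 * (3 * m%:R) ^+ N :> R.
  by rewrite exprMn exprS; ring.
rewrite ler_wpM2l ?exprn_ge0// lerXn2r ?nnegrE ?addr_ge0 ?logplus_ge0 ?mulr_ge0//.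
have m1 : (1 : R) <= m%:R by rewrite ler1n.
have ln2 : ln (2 : R) <= 1.
  have := @le_ln1Dx R 1; rewrite (_ : 1 + 1 = 2)//; apply; lra.
have lnm : ln ((2 : R) ^+ m.+1) <= m.+1%:R.
  by rewrite lnXn// -(mulr_natl (ln 2) m.+1) ler_piMr.
have : logplus ((2 : R) ^+ m.+1) <= m.+1%:R by rewrite ge_max lnm ler0n.
by rewrite -natr1; lra.
Qed.

Lemma eventually_lt_LlogL (phi : R -> R) (c : R) : 0 < c ->
  phi x / LlogL N%:R x @[x --> +oo] --> (0 : R) ->
  exists2 m : nat, (0 < m)%N & phi (2 ^+ m.+1) < c * (m%:R ^+ N * 2 ^+ m).
Proof.
move=> c0 /cvgrPdist_lt /(_ (c / (2 * 3 ^+ N))).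
have d0 : 0 < 2 * 3 ^+ N :> R by rewrite mulr_gt0 ?exprn_gt0.
move=> /(_ (divr_gt0 c0 d0)) [X [_ HX]].
pose m := (Num.bound `|X|).+1.
have Xm : X < 2 ^+ m.+1.
  apply: le_lt_trans (ler_norm X) _; apply: lt_trans (archi_boundP _) _ => //.
  rewrite -natrX ltr_nat; apply: (ltn_trans (ltn_expl _ (ltnSn 1))).
  by rewrite ltn_exp2l.
exists m => //; have := HX _ Xm; rewrite sub0r normrN.
have L0 : 0 < LlogL N%:R (2 ^+ m.+1) :> R.
  by apply: lt_le_trans (le_LlogL _ _) => //; rewrite ?exprn_gt0 ?exprn_ge0.
move=> /(le_lt_trans (ler_norm _)); rewrite ltr_pdivrMr// => /lt_le_trans; apply.
have := LlogL_pow2_le (ltn0Sn (Num.bound `|X|)); rewrite -/m => le_m.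
apply: le_trans (ler_wpM2l (ltW (divr_gt0 c0 d0)) le_m) _.
by rewrite [leLHS]mulrA divfK// lt0r_neq0.
Qed.

End sharpness.

Lemma integral_phi_indic d (T : measurableType d) (R : realType)
    (mu : {measure set T -> \bar R}) (E : set T) (phi : R -> R) (t : R) :
  measurable E -> 0 < t -> phi 0 = 0 ->
  (\int[mu]_x (phi (`|\1_E x| / t))%:E = (phi t^-1)%:E * mu E)%E.
Proof.
move=> mE t0 phi0; rewrite -(setTI E) -integral_cst//; last first.
  by rewrite setTI.
rewrite setTI [RHS]integral_mkcond; apply: eq_integral => x _.
rewrite patchE indicE; case: ifPn => xE; last by rewrite normr0 mul0r phi0.
by rewrite normr1 mul1r.
Qed.

(** Tested on the indicator of the extremal set, a weak-type bound would force [phi (2 ^+ m.+1)] to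
    be at least a constant times [m ^ n.-1 * 2 ^ m] for every [m >= 1], against the limit. *)
Lemma not_bounded_below_LlogL (R : realType) (n : nat) (A : set int) (phi : R -> R) :
  (1 < n)%N -> has_long_progressions A ->
  (forall x, 0 <= x -> 0 <= phi x) -> phi 0 = 0 ->
  phi x / LlogL n.-1%:R x @[x --> +oo] --> (0 : R) ->
  ~ bounded_to_weakL1 (@rectangles R n A) phi.
Proof.
move=> n1 hA phi_ge0 phi0 phi_lim [C HC].
pose c : R := 2 ^- n * n.-1%:R ^- n.-1.
have N0 : (0 : R) < n.-1%:R by rewrite ltr0n; lia.
have c0 : 0 < c by rewrite mulr_gt0 ?invr_gt0 ?exprn_gt0.
(* [C] may have any sign; this positive majorant can be divided by. *)
have C1 : 0 < `|C| + 1 by rewrite ltr_wpDl.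
have [m m0 phim] := eventually_lt_LlogL (divr_gt0 c0 C1) phi_lim.
have [E [mE /andP[E0 Eoo] lowE]] := @maximal_rectangles_lower R n A m n1 hA m0.
(* Half of [2 ^- m], so that the non-strict superlevel set of the lower bound lies in the strict one
   at height [t]. *)
pose t : R := 2 ^- m.+1.
have t0 : 0 < t by rewrite invr_gt0 exprn_gt0.
have m1E : measurable_fun setT (\1_E : Rn R n -> R) by exact: measurable_indic.
have upE := HC \1_E m1E t t0.
have sub : (lebesgue R n [set x | (2 ^- m)%:E <= maximal (@rectangles R n A) \1_E x] <=
    lebesgue R n [set x | t%:E < maximal (@rectangles R n A) \1_E x])%E.
  apply: le_lebesgue => x /=; apply: lt_le_trans.
  by rewrite lte_fin ltf_pV2 ?posrE ?exprn_gt0// exprS ltr_pMl ?exprn_gt0// ltr1n.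
have := le_trans lowE (le_trans sub upE).
rewrite integral_phi_indic// muleA -EFinM lee_pmul2r//; last first.
  by rewrite ge0_fin_numE.
rewrite lee_fin /t invrK -/c; apply/negP; rewrite -ltNge.
apply: (@le_lt_trans _ _ ((`|C| + 1) * phi (2 ^+ m.+1))).
  rewrite ler_wpM2r ?phi_ge0 ?exprn_ge0//.
  by rewrite (le_trans (ler_norm C))// lerDl.
rewrite mulrC -ltr_pdivlMr//; apply: lt_le_trans phim _.
by rewrite le_eqVlt; apply/orP; left; apply/eqP; ring.
Qed.

Theorem theorem3 (R : realType) (n : nat) (hn : (2 <= n)%N) :
  exists2 c : R, 0 < c &
  forall A : set int, has_long_progressions A ->
    (forall m : nat, (1 <= m)%N ->
      exists E : set (Rn R n),
        [/\ measurable E,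
            (0 < lebesgue R n E < +oo)%E &
            ((c * m%:R ^+ n.-1 * 2 ^+ m)%:E * lebesgue R n E <=
             lebesgue R n
               [set x | (2 ^- m)%:E <= maximal (@rectangles R n A) \1_E x])%E])
    /\ sharply_bounded (@rectangles R n A) n.-1%:R.
Proof.
exists (2 ^- n * n.-1%:R ^- n.-1).
  by rewrite mulr_gt0 ?invr_gt0 ?exprn_gt0// ltr0n; lia.
move=> A hA; split; first by move=> m; exact: maximal_rectangles_lower.
split; first by apply: maximal_rectangles_bounded; exact: ltnW.
move=> phi phi_ge0 phi0 _ _; exact: not_bounded_below_LlogL.
Qed.
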